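(* Let $\mathcal{N}$ be a model of the base theory $F$ ($=\mathrm{RCA}_0^*$). In $\mathcal{N}$, the following are equivalent: (a) The intersection of finitely many cofinite c.e. sets is cofinite. (b) $\mathrm{B}\Sigma^0_3$.
   Context: Setting: $\mathcal{N}=(N,\mathcal{P},+,\times,<,0,1)$ with $\mathcal{P}\subseteq 2^N$ is a (possibly nonstandard) second-order model of arithmetic; elements of $N$ are called integers and elements of $\mathcal{P}$ are called sets. $\mathcal{N}$ satisfies the base theory $F$, consisting of $P^-$ (Peano arithmetic without induction), $\mathrm{I}\Delta^0_0$, the totality of exponentiation, and $\Delta^0_1$-comprehension; $F$ is also called $\mathrm{RCA}_0^*$. A formula is $\Delta^0_0$ ($=\Sigma^0_0=\Pi^0_0$) if all its quantifiers are bounded number quantifiers; $\Sigma^0_{n+1}$ formulas are a block of existential number quantifiers followed by a $\Pi^0_n$ formula, and dually for $\Pi^0_{n+1}$. Number and set parameters are allowed. The c.e. sets are the $\Sigma^0_1$-definable subsets of $N$ (parameters allowed; they need not lie in $\mathcal{P}$); $W_e$ is the $e$th c.e. set, with stage-$s$ approximation $W_{e,s}$. $W_e$ is cofinite iff $\exists k\,\forall x>k\,\exists s\,(x\in W_{e,s})$. A finite collection of c.e. sets is a family $\{W_{f(i)}\mid i<n\}$ with $n\in N$ (possibly nonstandard) and $f$ a computable ($\Delta^0_1$-definable) total function. Thus (a) says: for all such $n,f$, if $\forall i<n\,\exists b_i\,\forall x>b_i\,\exists s\,(x\in W_{f(i),s})$ then $\exists b\,\forall i<n\,\forall x>b\,\exists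 s\,(x\in W_{f(i),s})$. $\mathrm{B}\Sigma^0_3$ is the scheme asserting, for every $\Sigma^0_3$ formula $P(i,b)$ and all $n\in N$: if $\forall i<n\,\exists b_i\,P(i,b_i)$ then $\exists b\,\forall i<n\,\exists b_i<b\,P(i,b_i)$. *)

(* Defs.v *)
Set Implicit Arguments.

(** ** Second-order structures for arithmetic *)

(* The sets are a family [is_set] of subsets of the carrier; subsets are predicates. *)
Record structure2 : Type := Structure2 {
  carrier :> Type;
  is_set : (carrier -> Prop) -> Prop;
  add : carrier -> carrier -> carrier;
  mul : carrier -> carrier -> carrier;
  lt : carrier -> carrier -> Prop;
  zero : carrier;
  one : carrier
}.

Arguments zero {s}.
Arguments one {s}.

Declare Scope model_scope.
Delimit Scope model_scope with M.
Infix "+" := (@add _) : model_scope.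
Infix "*" := (@mul _) : model_scope.
Infix "<" := (@lt _) : model_scope.
Notation "0" := (@zero _) : model_scope.
Notation "1" := (@one _) : model_scope.
Local Open Scope model_scope.

Definition set_of (M : structure2) : Type := {X : M -> Prop | is_set M X}.

(** ** Arithmetical formulas *)

(* Variables are de Bruijn indices; numbers enter as parameters through the
   valuation.  Set parameters are constants taken from [T], so a formula with
   no set parameter is interpreted without assuming that there is any set. *)
Inductive term : Type :=
| tVar (k : nat)
| tZero
| tOne
| tAdd (t u : term)
| tMul (t u : term).

Inductive form (T : Type) : Type :=
| fEq (t u : term)
| fLt (t u : term)
| fIn (t : term) (X : T)
| fNot (p : form T)
| fAnd (p q : form T)
| fOr (p q : form T)
| fImp (p q : form T)
| fBAll (t : term) (p : form T)
| fBEx (t : term) (p : form T)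
| fAll (p : form T)
| fEx (p : form T).

Fixpoint Delta0 (T : Type) (p : form T) : Prop :=
  match p with
  | fEq _ _ _ | fLt _ _ _ | fIn _ _ => True
  | fNot q | fBAll _ q | fBEx _ q => Delta0 q
  | fAnd q r | fOr q r | fImp q r => Delta0 q /\ Delta0 r
  | fAll _ | fEx _ => False
  end.

Inductive Sigma (T : Type) : nat -> form T -> Prop :=
| Sigma_Delta0 (p : form T) : Delta0 p -> Sigma 0 p
| Sigma_Pi (n : nat) (p : form T) : Pi n p -> Sigma (S n) p
| Sigma_Ex (n : nat) (p : form T) :
    Sigma (S n) p -> Sigma (S n) (fEx p)
with Pi (T : Type) : nat -> form T -> Prop :=
| Pi_Delta0 (p : form T) : Delta0 p -> Pi 0 p
| Pi_Sigma (n : nat) (p : form T) : Sigma n p -> Pi (S n) p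
| Pi_All (n : nat) (p : form T) :
    Pi (S n) p -> Pi (S n) (fAll p).

Definition scons (A : Type) (x : A) (rho : nat -> A) (k : nat) : A :=
  match k with
  | O => x
  | S k' => rho k'
  end.

Infix ".:" := (@scons _) (at level 55, right associativity) : model_scope.

Fixpoint eval {M : structure2} (rho : nat -> M) (t : term) : M :=
  match t with
  | tVar k => rho k
  | tZero => 0
  | tOne => 1
  | tAdd u v => eval rho u + eval rho v
  | tMul u v => eval rho u * eval rho v
  end.

(* The bound of a bounded quantifier is evaluated outside its scope. *)
Fixpoint sat {M : structure2} (rho : nat -> M) (p : form (set_of M)) : Prop :=
  match p with
  | fEq _ t u => eval rho t = eval rho u
  | fLt _ t u => eval rho t < eval rho u
  | fIn t X => proj1_sig X (eval rho t)
  | fNot q => ~ sat rho q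
  | fAnd q r => sat rho q /\ sat rho r
  | fOr q r => sat rho q \/ sat rho r
  | fImp q r => sat rho q -> sat rho r
  | fBAll t q => forall x : M, x < eval rho t -> sat (x .: rho) q
  | fBEx t q => exists x : M, x < eval rho t /\ sat (x .: rho) q
  | fAll q => forall x : M, sat (x .: rho) q
  | fEx q => exists x : M, sat (x .: rho) q
  end.

(** ** The base theory *)

(* The axioms of discretely ordered semirings. *)
Record PAminus (M : structure2) : Prop := {
  pa_addA : forall x y z : M, (x + y) + z = x + (y + z);
  pa_addC : forall x y : M, x + y = y + x;
  pa_mulA : forall x y z : M, (x * y) * z = x * (y * z);
  pa_mulC : forall x y : M, x * y = y * x;
  pa_distr : forall x y z : M, x * (y + z) = x * y + x * z;
  pa_add0 : forall x : M, x + 0 = x;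
  pa_mul0 : forall x : M, x * 0 = 0;
  pa_mul1 : forall x : M, x * 1 = x;
  pa_ltT : forall x y z : M, x < y -> y < z -> x < z;
  pa_ltI : forall x : M, ~ x < x;
  pa_total : forall x y : M, x < y \/ x = y \/ y < x;
  pa_ltD : forall x y z : M, x < y -> x + z < y + z;
  pa_ltM : forall x y z : M, 0 < z -> x < y -> x * z < y * z;
  pa_sub : forall x y : M, x < y -> exists z : M, x + z = y;
  pa_lt01 : 0 < (1 : M);
  pa_discrete : forall x : M, 0 < x -> x = 1 \/ 1 < x;
  pa_ge0 : forall x : M, x = 0 \/ 0 < x
}.

Definition IDelta0 (M : structure2) : Prop :=
  forall (p : form (set_of M)) (rho : nat -> M), Delta0 p ->
    sat (0 .: rho) p ->
    (forall x : M, sat (x .: rho) p -> sat (x + 1 .: rho) p) ->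
    forall x : M, sat (x .: rho) p.

Definition Delta1_CA (M : structure2) : Prop :=
  forall (p q : form (set_of M)) (rho : nat -> M), Sigma 1 p -> Pi 1 q ->
    (forall x : M, sat (x .: rho) p <-> sat (x .: rho) q) ->
    exists X : M -> Prop, is_set M X /\ forall x : M, X x <-> sat (x .: rho) p.

(* Goedel's beta function: [v] is the remainder of [c] modulo [1 + (i+1)d]. *)
Definition beta {M : structure2} (c d i v : M) : Prop :=
  v < 1 + (i + 1) * d /\ exists q : M, c = q * (1 + (i + 1) * d) + v.

(* y = a ^ x, witnessed by a code of the sequence a ^ 0, ..., a ^ x. *)
Definition is_pow {M : structure2} (a x y : M) : Prop :=
  exists c d : M,
    beta c d 0 1 /\
    (forall i : M, i < x ->
       exists v : M, beta c d i v /\ beta c d (i + 1) (a * v)) /\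
    beta c d x y.

Definition exp_total (M : structure2) : Prop :=
  forall a x : M, exists y : M, is_pow a x y.

Record RCA0star (M : structure2) : Prop := {
  rca_PAminus : PAminus M;
  rca_IDelta0 : IDelta0 M;
  rca_exp : exp_total M;
  rca_Delta1_CA : Delta1_CA M
}.

(** ** Computability inside a model *)

Definition pair {M : structure2} (x y : M) : M := (x + y) * (x + y) + x.

Fixpoint num (M : structure2) (k : nat) : M :=
  match k with
  | O => 0
  | S k' => num M k' + 1
  end.

(* The [u]-th binary digit of [c] is 1; numbers code finite sets this way. *)
Definition in_code {M : structure2} (u c : M) : Prop :=
  exists p q r : M,
    is_pow (1 + 1) u p /\ r < p /\ c = ((q + q) + 1) * p + r.

(* Indices of the partial functions computable from the oracle [A].  They are
   unary, several arguments being packed with [pair]: the functions are generated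
   from constants, the identity, the two projections, addition, multiplication
   and the characteristic functions of < and of [A], by composition, pairing
   and minimization.  [justified A D e a v] says that the claim
   "the function with index [e] maps [a] to [v]" follows by one defining clause
   from the claims in [D]. *)
Inductive justified {M : structure2} (A : M -> Prop) (D : M -> M -> M -> Prop) :
  M -> M -> M -> Prop :=
| j_const (c a : M) : justified A D (pair (num M 0) c) a c
| j_id (a : M) : justified A D (pair (num M 1) 0) a a
| j_fst (x y : M) : justified A D (pair (num M 2) 0) (pair x y) x
| j_snd (x y : M) : justified A D (pair (num M 3) 0) (pair x y) y
| j_add (x y : M) : justified A D (pair (num M 4) 0) (pair x y) (x + y)
| j_mul (x y : M) : justified A D (pair (num M 5) 0) (pair x y) (x * y)
| j_lt_true (x y : M) :
    x < y -> justified A D (pair (num M 6) 0) (pair x y) 1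
| j_lt_false (x y : M) :
    ~ x < y -> justified A D (pair (num M 6) 0) (pair x y) 0
| j_oracle_in (a : M) : A a -> justified A D (pair (num M 7) 0) a 1
| j_oracle_out (a : M) : ~ A a -> justified A D (pair (num M 7) 0) a 0
| j_comp (e1 e2 a b v : M) :
    D e2 a b -> D e1 b v ->
    justified A D (pair (num M 8) (pair e1 e2)) a v
| j_pair (e1 e2 a u v : M) :
    D e1 a u -> D e2 a v ->
    justified A D (pair (num M 9) (pair e1 e2)) a (pair u v)
| j_mu (e a v : M) :
    D e (pair a v) 0 ->
    (forall u : M, u < v -> exists w : M, w <> 0 /\ D e (pair a u) w) ->
    justified A D (pair (num M 10) e) a v.

Definition claim {M : structure2} (c e a v : M) : Prop :=
  in_code (pair e (pair a v)) c.

(* Justification refers only to smaller indices, so no order on the claims of a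
   computation has to be recorded. *)
Definition computation {M : structure2} (A : M -> Prop) (c : M) : Prop :=
  forall e a v : M, claim c e a v -> justified A (claim c) e a v.

(* [W_stage A e s] is the stage-[s] approximation to the domain [W A e] of
   the [e]-th partial [A]-computable function. *)
Definition W_stage {M : structure2} (A : M -> Prop) (e s x : M) : Prop :=
  exists c v : M, c < s /\ computation A c /\ claim c e x v.

Definition W {M : structure2} (A : M -> Prop) (e x : M) : Prop :=
  exists s : M, W_stage A e s x.

Definition computable {M : structure2} (f : M -> M) : Prop :=
  exists (p q : form (set_of M)) (rho : nat -> M),
    Sigma 1 p /\ Pi 1 q /\
    forall x y : M,
      (f x = y <-> sat (x .: y .: rho) p) /\
      (f x = y <-> sat (x .: y .: rho) q).

Definition cofinite {M : structure2} (X : M -> Prop) : Prop :=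
  exists k : M, forall x : M, k < x -> X x.

(** ** The two principles *)

(* The oracle [A] supplies the set parameter allowed in the Sigma^0_1
   definition of a c.e. set; number parameters are absorbed by the indices. *)
Definition cofinite_intersections (M : structure2) : Prop :=
  forall (A : M -> Prop) (n : M) (f : M -> M),
    is_set M A -> computable f ->
    (forall i : M, i < n -> cofinite (W A (f i))) ->
    cofinite (fun x : M => forall i : M, i < n -> W A (f i) x).

Definition BSigma (M : structure2) (k : nat) : Prop :=
  forall (p : form (set_of M)) (rho : nat -> M) (n : M), Sigma k p ->
    (forall i : M, i < n -> exists b : M, sat (i .: b .: rho) p) ->
    exists b : M, forall i : M, i < n ->
      exists bi : M, bi < b /\ sat (i .: bi .: rho) p.

(* Main.v *)
(* For BSigma^0_3 => (a): finite sets coded by binary digits make "c codes a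
   computation" Delta^0_0 relative to sets, so "x in W_f(i) for all x > b" is Pi^0_2,
   and BSigma^0_3 bounds b.

   Conversely, with an oracle every family of sets {s | exists t, R(i,s,t)}, R a
   Delta^0_0 relation, is a family W_f(i) with f computable: f(i) searches for t.
   Applying (a) to three such families of cofinite sets gives, one after the other,
   strong bounding for Sigma^0_1 formulas (hence ISigma^0_1),
   strong bounding for Sigma^0_2 formulas, and BPi^0_2, hence BSigma^0_3.  The
   strong forms provide the least witnesses that the next construction is based on. *)

Require Import Defs.
From Stdlib Require Import Classical FunctionalExtensionality Setoid Ring Arith.
Local Open Scope model_scope.

(** Induction and least witnesses are at first available only for Delta^0_0 relations with set
    parameters, which [D0] collects; comprehension adds every Delta^0_1 relation, exponentiation
    included. A bound is extracted from (a) by removing from the i-th set a stage that dominates the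
    wanted witness: the common bound on the complements then bounds the witnesses. As the sets are
    c.e., the removal of a stage must be a Pi^0_1 matter. The first two families consist of cofinite
    sets whether or not a witness exists, which is why they give strong bounding; in the third,
    cofiniteness rests on the existence of a witness, and only ordinary bounding results. *)

Section Model.
Context {M : structure2} (HM : RCA0star M).

Let PA : PAminus M := rca_PAminus HM.

(** * Arithmetic *)

Lemma model_semi_ring : semi_ring_theory (0 : M) 1 (@add M) (@mul M) eq.
Proof.
  pose proof (pa_addC PA) as AC; pose proof (pa_mulC PA) as MC.
  constructor; intros.
  - rewrite AC; apply (pa_add0 PA).
  - apply AC.
  - symmetry; apply (pa_addA PA).
  - rewrite MC; apply (pa_mul1 PA).
  - rewrite MC; apply (pa_mul0 PA).
  - apply MC.
  - symmetry; apply (pa_mulA PA).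
  - rewrite MC, (pa_distr PA), (MC p), (MC p); reflexivity.
Qed.

Add Ring model_ring : model_semi_ring.

Lemma lt_trans (x y z : M) : x < y -> y < z -> x < z.
Proof. apply (pa_ltT PA). Qed.

Lemma lt_irrefl (x : M) : ~ x < x.
Proof. apply (pa_ltI PA). Qed.

Lemma lt_total (x y : M) : x < y \/ x = y \/ y < x.
Proof. apply (pa_total PA). Qed.

Lemma lt_not0 (x : M) : ~ x < 0.
Proof.
  intros H; destruct (pa_ge0 PA x) as [-> | H0].
  - exact (lt_irrefl _ H).
  - exact (lt_irrefl _ (lt_trans _ _ _ H H0)).
Qed.

Lemma lt_add_r (x y z : M) : x < y -> x + z < y + z.
Proof. apply (pa_ltD PA). Qed.

Lemma lt_succ (x : M) : x < x + 1.
Proof.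
  replace x with (0 + x) at 1 by ring.
  replace (x + 1) with (1 + x) by ring.
  apply lt_add_r, (pa_lt01 PA).
Qed.

(** With [lt_elim] it trades an inequality for an equation with an explicit difference, which [ring]
    can check; the long arguments passed to it below are such differences. *)
Lemma lt_intro (x y z : M) : y = x + z + 1 -> x < y.
Proof.
  intros ->.
  destruct (pa_ge0 PA z) as [-> | H].
  - replace (x + 0 + 1) with (x + 1) by ring; apply lt_succ.
  - apply lt_trans with (x + z); [| apply lt_succ].
    replace x with (0 + x) at 1 by ring.
    replace (x + z) with (z + x) by ring.
    apply lt_add_r, H.
Qed.

Lemma lt_elim (x y : M) : x < y -> exists z, y = x + z + 1.
Proof.
  intros H; destruct (pa_sub PA _ _ H) as [z <-].
  destruct (pa_ge0 PA z) as [-> | H0].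
  - exfalso; apply (lt_irrefl x); replace (x + 0) with x in H by ring; exact H.
  - destruct (pa_discrete PA _ H0) as [-> | H1].
    + exists 0; ring.
    + destruct (pa_sub PA _ _ H1) as [w <-]; exists w; ring.
Qed.

Lemma add_cancel (x y z : M) : x + z = y + z -> x = y.
Proof.
  intros E; destruct (lt_total x y) as [H | [H | H]]; trivial;
  apply (lt_add_r _ _ z) in H; rewrite E in H; destruct (lt_irrefl _ H).
Qed.

(* In a discrete order [x < y] means [x + 1 <= y], whence the extra [1]. *)
Lemma lt_add (x y z w : M) : x < y -> z < w -> x + z + 1 < y + w.
Proof.
  intros H K; destruct (lt_elim _ _ H) as [u ->], (lt_elim _ _ K) as [v ->].
  apply (lt_intro _ _ (u + v)); ring.
Qed.

Lemma lt_false (x y : M) : x < y -> x = y -> False.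
Proof. intros H ->; exact (lt_irrefl _ H). Qed.

(** [x < y + 1] is the form in which x <= y appears throughout. *)
Lemma le_cases (x y : M) : x < y + 1 <-> x < y \/ x = y.
Proof.
  split.
  - intros H; destruct (lt_total x y) as [K | [K | K]]; auto.
    exfalso; apply (lt_false _ _ (lt_add _ _ _ _ H K)); ring.
  - intros [H | ->]; [apply lt_trans with (1 := H) |]; apply lt_succ.
Qed.

Lemma add_lt_cancel (x y z : M) : x + z < y + z -> x < y.
Proof.
  intros H; destruct (lt_total x y) as [K | [-> | K]]; trivial.
  - destruct (lt_irrefl _ H).
  - destruct (lt_irrefl _ (lt_trans _ _ _ H (lt_add_r _ _ z K))).
Qed.

Lemma le_refl (x : M) : x < x + 1.
Proof. apply lt_succ. Qed.

Lemma lt_le (x y : M) : x < y -> x < y + 1.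
Proof. intros; apply le_cases; auto. Qed.

Lemma not_lt (x y : M) : ~ x < y <-> y < x + 1.
Proof.
  rewrite le_cases; split.
  - intros H; destruct (lt_total x y) as [K | [K | K]]; auto; contradiction.
  - intros [H | ->] K; [exact (lt_irrefl _ (lt_trans _ _ _ H K)) | exact (lt_irrefl _ K)].
Qed.

Lemma lt_le_trans (x y z : M) : x < y -> y < z + 1 -> x < z.
Proof. intros H K; apply le_cases in K as [K | <-]; eauto using lt_trans. Qed.

Lemma le_lt_trans (x y z : M) : x < y + 1 -> y < z -> x < z.
Proof. intros H K; apply le_cases in H as [H | ->]; eauto using lt_trans. Qed.

Lemma le_trans (x y z : M) : x < y + 1 -> y < z + 1 -> x < z + 1.
Proof. intros H K; apply le_cases in H as [H | ->]; eauto using lt_trans, lt_le, lt_le_trans. Qed.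

Lemma zero_or_succ (x : M) : x = 0 \/ exists y, x = y + 1.
Proof.
  destruct (pa_ge0 PA x) as [H | H]; auto.
  right; destruct (lt_elim _ _ H) as [y ->]; exists y; ring.
Qed.

Lemma euclid_unique (m q q' r r' : M) :
  r < m -> r' < m -> q * m + r = q' * m + r' -> q = q' /\ r = r'.
Proof.
  assert (A : forall q q' r r', r < m -> q * m + r = q' * m + r' -> ~ q < q').
  { intros a b c d Hc E H; destruct (lt_elim _ _ H) as [u ->].
    destruct (lt_elim _ _ Hc) as [v ->].
    assert (K : a * (c + v + 1) + c < (a + u + 1) * (c + v + 1) + d).
    { apply (lt_intro _ _ (u * (c + v + 1) + v + d)); ring. }
    exact (lt_false _ _ K E). }
  intros Hr Hr' E.
  destruct (lt_total q q') as [H | [-> | H]].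
  - destruct (A _ _ _ _ Hr E H).
  - split; trivial; apply (add_cancel _ _ (q' * m)).
    replace (r + q' * m) with (q' * m + r) by ring; rewrite E; ring.
  - destruct (A _ _ _ _ Hr' (eq_sym E) H).
Qed.

Lemma le_pair_l (x y : M) : x < pair x y + 1.
Proof.
  unfold pair; destruct (zero_or_succ (x + y)) as [H | [u H]]; rewrite H.
  - apply (lt_intro _ _ 0); ring.
  - apply (lt_intro _ _ ((u + 1) * (u + 1))); ring.
Qed.

Lemma le_pair_r (x y : M) : y < pair x y + 1.
Proof.
  unfold pair; destruct (zero_or_succ y) as [-> | [u ->]].
  - apply (lt_intro _ _ ((x + 0) * (x + 0) + x)); ring.
  - apply (lt_intro _ _ ((x + u) * (x + u) + x + x + x + u)); ring.
Qed.

(** [pair x y] is at least (x+y)^2 and less than (x+y+1)^2, so it determines x + y, and x is what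
    remains. The pairing is not onto. *)
Lemma pair_inj (x y x' y' : M) : pair x y = pair x' y' -> x = x' /\ y = y'.
Proof.
  assert (A : forall x y x' y' : M, pair x y = pair x' y' -> ~ x + y < x' + y').
  { intros a b c d E H; unfold pair in E.
    destruct (lt_elim _ _ H) as [u Hu]; rewrite Hu in E.
    refine (lt_false _ _ _ E).
    apply (lt_intro _ _ (a + (b + b) + (a + b) * (u + u) + u * u + u + u + c)); ring. }
  intros E; assert (S : x + y = x' + y').
  { destruct (lt_total (x + y) (x' + y')) as [H | [H | H]]; trivial.
    - destruct (A _ _ _ _ E H).
    - destruct (A _ _ _ _ (eq_sym E) H). }
  assert (x = x').
  { unfold pair in E; rewrite S in E.
    apply (add_cancel _ _ ((x' + y') * (x' + y'))).
    replace (x + (x' + y') * (x' + y')) with ((x' + y') * (x' + y') + x) by ring.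
    rewrite E; ring. }
  subst x'; split; trivial; apply (add_cancel _ _ x).
  replace (y + x) with (x + y) by ring; rewrite S; ring.
Qed.

(** * Definability *)

Fixpoint tren (g : nat -> nat) (t : term) : term :=
  match t with
  | tVar k => tVar (g k)
  | tZero => tZero
  | tOne => tOne
  | tAdd t u => tAdd (tren g t) (tren g u)
  | tMul t u => tMul (tren g t) (tren g u)
  end.

Definition up (g : nat -> nat) (k : nat) : nat :=
  match k with O => O | S k' => S (g k') end.

Fixpoint fren (T : Type) (g : nat -> nat) (p : form T) : form T :=
  match p with
  | fEq _ t u => fEq T (tren g t) (tren g u)
  | fLt _ t u => fLt T (tren g t) (tren g u)
  | fIn t X => fIn (tren g t) X
  | fNot q => fNot (fren T g q)
  | fAnd q r => fAnd (fren T g q) (fren T g r)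
  | fOr q r => fOr (fren T g q) (fren T g r)
  | fImp q r => fImp (fren T g q) (fren T g r)
  | fBAll t q => fBAll (tren g t) (fren T (up g) q)
  | fBEx t q => fBEx (tren g t) (fren T (up g) q)
  | fAll q => fAll (fren T (up g) q)
  | fEx q => fEx (fren T (up g) q)
  end.
Arguments fren {T}.

Lemma Delta0_fren (T : Type) (p : form T) g : Delta0 p -> Delta0 (fren g p).
Proof. revert g; induction p; simpl; firstorder. Qed.

Lemma eval_tren (rho : nat -> M) g t : eval rho (tren g t) = eval (fun k => rho (g k)) t.
Proof. induction t; simpl; congruence. Qed.

Lemma scons_up (x : M) rho g : (fun k => (x .: rho) (up g k)) = x .: (fun k => rho (g k)).
Proof. apply functional_extensionality; intros [|k]; reflexivity. Qed.

Lemma sat_fren (rho : nat -> M) g p : sat rho (fren g p) <-> sat (fun k => rho (g k)) p.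
Proof.
  revert rho g; induction p; intros rho g; simpl;
    rewrite ?eval_tren; try reflexivity;
    try (setoid_rewrite IHp; setoid_rewrite scons_up; reflexivity);
    try (rewrite IHp1, IHp2; reflexivity).
  rewrite IHp; reflexivity.
Qed.

(* [s] sends each variable of a formula to a coordinate of the environment [r] or
   to a number parameter; [D0] and [T0] are thus definability with parameters. *)
Definition interp (s : nat -> nat + M) (r : nat -> M) (k : nat) : M :=
  match s k with inl j => r j | inr a => a end.

Definition D0 (P : (nat -> M) -> Prop) : Prop :=
  exists (p : form (set_of M)) s, Delta0 p /\ forall r, P r <-> sat (interp s r) p.

Definition T0 (t : (nat -> M) -> M) : Prop :=
  exists u s, forall r, t r = eval (interp s r) u.

(** Even variables carry the first assignment and odd variables the second, so formulas with
    unrelated parameters can be joined. *)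
Lemma merge (s1 s2 : nat -> nat + M) :
  exists s g1 g2, (forall r, (fun k => interp s r (g1 k)) = interp s1 r) /\
                  (forall r, (fun k => interp s r (g2 k)) = interp s2 r).
Proof.
  exists (fun k => if Nat.even k then s1 (Nat.div2 k) else s2 (Nat.div2 k)).
  exists (fun k => (2 * k)%nat), (fun k => S (2 * k)); split; intros r;
    apply functional_extensionality; intros k; unfold interp.
  - rewrite Nat.even_even, Nat.div2_double; reflexivity.
  - replace (S (2 * k)) with (2 * k + 1)%nat by ring.
    rewrite Nat.even_odd, Nat.add_1_r, Nat.div2_succ_double; reflexivity.
Qed.

Lemma D0_ext P Q : (forall r, P r <-> Q r) -> D0 P -> D0 Q.
Proof.
  intros E (p & s & Hp & H); exists p, s; split; trivial.
  intros r; rewrite <- E; apply H.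
Qed.

(** * Closure properties of definable terms and relations *)

Lemma T0_const a : T0 (fun _ => a).
Proof. exists (tVar 0), (fun _ => inr a); reflexivity. Qed.

Lemma T0_var k : T0 (fun r => r k).
Proof. exists (tVar k), inl; reflexivity. Qed.

Lemma T0_add t u : T0 t -> T0 u -> T0 (fun r => t r + u r).
Proof.
  intros (a & s1 & H1) (b & s2 & H2); destruct (merge s1 s2) as (s & g1 & g2 & E1 & E2).
  exists (tAdd (tren g1 a) (tren g2 b)), s; intros r; simpl.
  rewrite !eval_tren, E1, E2, H1, H2; reflexivity.
Qed.

Lemma T0_mul t u : T0 t -> T0 u -> T0 (fun r => t r * u r).
Proof.
  intros (a & s1 & H1) (b & s2 & H2); destruct (merge s1 s2) as (s & g1 & g2 & E1 & E2).
  exists (tMul (tren g1 a) (tren g2 b)), s; intros r; simpl.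
  rewrite !eval_tren, E1, E2, H1, H2; reflexivity.
Qed.

Lemma T0_pair t u : T0 t -> T0 u -> T0 (fun r => pair (t r) (u r)).
Proof. intros; unfold pair; auto using T0_add, T0_mul. Qed.

Lemma D0_lt t u : T0 t -> T0 u -> D0 (fun r => t r < u r).
Proof.
  intros (a & s1 & H1) (b & s2 & H2); destruct (merge s1 s2) as (s & g1 & g2 & E1 & E2).
  exists (fLt _ (tren g1 a) (tren g2 b)), s; split; [exact I |]; intros r; simpl.
  rewrite !eval_tren, E1, E2, H1, H2; reflexivity.
Qed.

Lemma D0_eq t u : T0 t -> T0 u -> D0 (fun r => t r = u r).
Proof.
  intros (a & s1 & H1) (b & s2 & H2); destruct (merge s1 s2) as (s & g1 & g2 & E1 & E2).
  exists (fEq _ (tren g1 a) (tren g2 b)), s; split; [exact I |]; intros r; simpl.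
  rewrite !eval_tren, E1, E2, H1, H2; reflexivity.
Qed.

Lemma D0_set X t : is_set M X -> T0 t -> D0 (fun r => X (t r)).
Proof.
  intros HX (a & s & H); exists (fIn a (exist _ X HX)), s; split; [exact I |].
  intros r; simpl; rewrite H; reflexivity.
Qed.

Lemma D0_not P : D0 P -> D0 (fun r => ~ P r).
Proof.
  intros (p & s & Hp & H); exists (fNot p), s; split; trivial.
  intros r; simpl; rewrite H; reflexivity.
Qed.

Lemma D0_and P Q : D0 P -> D0 Q -> D0 (fun r => P r /\ Q r).
Proof.
  intros (p & s1 & Hp & H1) (q & s2 & Hq & H2).
  destruct (merge s1 s2) as (s & g1 & g2 & E1 & E2).
  exists (fAnd (fren g1 p) (fren g2 q)), s; split; [simpl; auto using Delta0_fren |].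
  intros r; simpl; rewrite !sat_fren, E1, E2, H1, H2; reflexivity.
Qed.

Lemma D0_or P Q : D0 P -> D0 Q -> D0 (fun r => P r \/ Q r).
Proof.
  intros HP HQ; apply D0_ext with (fun r => ~ (~ P r /\ ~ Q r)).
  - intros r; tauto.
  - auto using D0_not, D0_and.
Qed.

Lemma D0_imp P Q : D0 P -> D0 Q -> D0 (fun r => P r -> Q r).
Proof.
  intros HP HQ; apply D0_ext with (fun r => ~ (P r /\ ~ Q r)).
  - intros r; tauto.
  - auto using D0_not, D0_and.
Qed.

Lemma D0_iff P Q : D0 P -> D0 Q -> D0 (fun r => P r <-> Q r).
Proof. intros; unfold iff; auto using D0_and, D0_imp. Qed.

Lemma D0_bex t (Q : M -> (nat -> M) -> Prop) :
  T0 t -> D0 (fun r => Q (r 0%nat) (fun k => r (S k))) ->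
  D0 (fun r => exists x, x < t r /\ Q x r).
Proof.
  intros (a & s2 & H2) (p & s1 & Hp & H1).
  (* Variables standing for coordinate 0, the quantified number, get the dummy value 0 here; [h]
     redirects them to the variable bound by [fBEx] and moves the others up by one. *)
  destruct (merge (fun k => match s1 k with
                            | inl O => inr 0 | inl (S j) => inl j | inr c => inr c
                            end) s2) as (s & g1 & g2 & E1 & E2).
  pose (h := fun k => match s1 k with inl O => O | _ => S (g1 k) end).
  exists (fBEx (tren g2 a) (fren h p)), s; split; [simpl; auto using Delta0_fren |].
  intros r; simpl; rewrite eval_tren, E2, <- H2.
  assert (E : forall x, sat (x .: interp s r) (fren h p) <-> Q x r).
  { intros x; rewrite sat_fren, (H1 (x .: r)).
    replace (fun k => (x .: interp s r) (h k)) with (interp s1 (x .: r)); [reflexivity |].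
    apply functional_extensionality; intros k.
    pose proof (f_equal (fun w => w k) (E1 r)) as E; simpl in E.
    unfold interp at 2 in E.
    unfold interp at 1, h; destruct (s1 k) as [[|j] | c]; simpl; congruence. }
  setoid_rewrite E; reflexivity.
Qed.

Lemma D0_ball t (Q : M -> (nat -> M) -> Prop) :
  T0 t -> D0 (fun r => Q (r 0%nat) (fun k => r (S k))) ->
  D0 (fun r => forall x, x < t r -> Q x r).
Proof.
  intros Ht HQ.
  apply D0_ext with (fun r => ~ exists x, x < t r /\ ~ Q x r).
  - intros r; split.
    + intros H x Hx; apply NNPP; intros K; apply H; eauto.
    + intros H (x & Hx & K); auto.
  - apply D0_not, (D0_bex t (fun x r => ~ Q x r)); trivial; apply D0_not, HQ.
Qed.

Lemma D0_subst P f : D0 P -> D0 (fun r => P (interp f r)).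
Proof.
  intros (p & s & Hp & H).
  exists p, (fun k => match s k with inl j => f j | inr a => inr a end); split; trivial.
  intros r; rewrite H.
  match goal with |- sat ?a p <-> sat ?b p => replace b with a; [reflexivity |] end.
  apply functional_extensionality; intros k; unfold interp.
  destruct (s k); reflexivity.
Qed.

Lemma D0_sat p rho : Delta0 p -> D0 (fun r => sat (interp rho r) p).
Proof. intros Hp; exists p, rho; split; trivial; reflexivity. Qed.

(** Leads back from [D0] to actual formulas, as the axioms require: coordinates 0 to 3 become free
    variables and the parameters go into the valuation. Two relations share one valuation because
    Delta^0_1 comprehension compares two formulas under the same one. *)
Lemma D0_forms4 P Q : D0 P -> D0 Q -> exists (p q : form (set_of M)) rho,
  Delta0 p /\ Delta0 q /\ forall x y z w,
    (P (x .: y .: z .: w .: fun _ => 0) <-> sat (x .: y .: z .: w .: rho) p) /\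
    (Q (x .: y .: z .: w .: fun _ => 0) <-> sat (x .: y .: z .: w .: rho) q).
Proof.
  intros (p & s1 & Hp & HP) (q & s2 & Hq & HQ).
  destruct (merge s1 s2) as (s & g1 & g2 & E1 & E2).
  pose (h := fun k => match s k with inl 0 => 0 | inl 1 => 1 | inl 2 => 2 | inl 3 => 3
                                   | _ => 4 + k end%nat).
  exists (fren (fun k => h (g1 k)) p), (fren (fun k => h (g2 k)) q).
  exists (fun k => match s k with inl _ => 0 | inr a => a end).
  split; [auto using Delta0_fren |]; split; [auto using Delta0_fren |].
  intros x y z w; rewrite !sat_fren, HP, HQ, <- E1, <- E2.
  match goal with |- (_ <-> sat (fun k => ?rho _) _) /\ _ =>
    assert (E : forall k, rho (h k) = interp s (x .: y .: z .: w .: fun _ => 0) k) end.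
  { intros k; unfold interp, h.
    destruct (s k) as [[|[|[|[|j]]]] | c] eqn:E; simpl; rewrite ?E; reflexivity. }
  split; match goal with |- sat ?a _ <-> sat ?b _ => replace b with a; [reflexivity |] end;
    apply functional_extensionality; intros k; symmetry; apply E.
Qed.

Lemma D0_form1 P : D0 P -> exists (p : form (set_of M)) rho, Delta0 p /\
  forall x, P (x .: fun _ => 0) <-> sat (x .: rho) p.
Proof.
  intros H; pose proof (D0_subst _ (fun k => match k with O => inl O | _ => inr 0 end) H) as H'.
  destruct (D0_forms4 _ _ H' H') as (p & q & rho & Hp & _ & E).
  exists p, (0 .: 0 .: 0 .: rho); split; trivial.
  intros x; rewrite <- (proj1 (E x 0 0 0)).
  match goal with |- P ?a <-> P ?b => replace b with a; [reflexivity |] end.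
  apply functional_extensionality; intros [|k]; reflexivity.
Qed.

(** * Induction, comprehension and substitution for definable relations *)

Lemma Delta0_ind (P : M -> Prop) : D0 (fun r => P (r 0%nat)) ->
  P 0 -> (forall x, P x -> P (x + 1)) -> forall x, P x.
Proof.
  intros H H0 HS x; destruct (D0_form1 _ H) as (p & rho & Hp & E).
  apply E, (rca_IDelta0 HM); trivial; [apply E, H0 |].
  intros y Hy; apply E, HS, E, Hy.
Qed.

Lemma Delta0_comprehension (P : M -> Prop) : D0 (fun r => P (r 0%nat)) ->
  exists X, is_set M X /\ forall x, X x <-> P x.
Proof.
  intros H; destruct (D0_form1 _ H) as (p & rho & Hp & E).
  pose proof (rca_Delta1_CA HM : Delta1_CA M) as CA; destruct (CA p p rho) as (X & HX & HE).
  - apply Sigma_Pi, Pi_Delta0, Hp.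
  - apply Pi_Sigma, Sigma_Delta0, Hp.
  - reflexivity.
  - exists X; split; trivial; intros x; rewrite HE; symmetry; apply E.
Qed.

(** The predicate is a set by comprehension, and membership of a term in a set is atomic; this takes
    the place of substituting terms into formulas. *)
Lemma D0_app1 P t : D0 (fun r => P (r 0%nat)) -> T0 t -> D0 (fun r => P (t r)).
Proof.
  intros H Ht; destruct (Delta0_comprehension _ H) as (X & HX & E).
  apply D0_ext with (fun r => X (t r)); [intros; apply E | apply D0_set; trivial].
Qed.

Ltac term := solve [repeat first
  [apply T0_const | apply T0_var | apply T0_pair | apply T0_add | apply T0_mul]].

Ltac def_step := cbv beta; first
  [ apply D0_lt; term | apply D0_eq; term
  | apply D0_iff | apply D0_not | apply D0_and | apply D0_or
  | apply D0_bex; [term |] | apply D0_ball; [term |] | apply D0_imp].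

Lemma D0_app2 (P : M -> M -> Prop) t u : D0 (fun r => P (r 0%nat) (r 1%nat)) ->
  T0 t -> T0 u -> D0 (fun r => P (t r) (u r)).
Proof.
  intros H Ht Hu.
  apply D0_ext with (fun r => (fun w => exists x, x < w + 1 /\ exists y, y < w + 1 /\
    w = pair x y /\ P x y) (pair (t r) (u r))).
  - intros r; split.
    + intros (x & _ & y & _ & E & K); apply pair_inj in E as [-> ->]; exact K.
    + intros K; exists (t r); split; [apply le_pair_l |].
      exists (u r); split; [apply le_pair_r |]; auto.
  - apply (D0_app1 (fun w => exists x, x < w + 1 /\ exists y, y < w + 1 /\
      w = pair x y /\ P x y)); [| apply T0_pair; trivial].
    repeat def_step.
    apply (D0_subst _ (fun k => match k with O => inl 1 | _ => inl 0 end%nat) H).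
Qed.

Lemma D0_app3 (P : M -> M -> M -> Prop) t u v :
  D0 (fun r => P (r 0%nat) (r 1%nat) (r 2%nat)) ->
  T0 t -> T0 u -> T0 v -> D0 (fun r => P (t r) (u r) (v r)).
Proof.
  intros H Ht Hu Hv.
  apply D0_ext with (fun r => (fun w z => exists x, x < w + 1 /\ exists y, y < w + 1 /\
    w = pair x y /\ P x y z) (pair (t r) (u r)) (v r)).
  - intros r; split.
    + intros (x & _ & y & _ & E & K); apply pair_inj in E as [-> ->]; exact K.
    + intros K; exists (t r); split; [apply le_pair_l |].
      exists (u r); split; [apply le_pair_r |]; auto.
  - apply (D0_app2 (fun w z => exists x, x < w + 1 /\ exists y, y < w + 1 /\
      w = pair x y /\ P x y z)); [| apply T0_pair; trivial | trivial].
    repeat def_step.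
    apply (D0_subst _ (fun k => match k with O => inl 1 | 1 => inl 0 | _ => inl 3 end%nat) H).
Qed.

Lemma D0_app4 (P : M -> M -> M -> M -> Prop) t u v v' :
  D0 (fun r => P (r 0%nat) (r 1%nat) (r 2%nat) (r 3%nat)) ->
  T0 t -> T0 u -> T0 v -> T0 v' -> D0 (fun r => P (t r) (u r) (v r) (v' r)).
Proof.
  intros H Ht Hu Hv Hv'.
  apply D0_ext with (fun r => (fun w z z' => exists x, x < w + 1 /\ exists y, y < w + 1 /\
    w = pair x y /\ P x y z z') (pair (t r) (u r)) (v r) (v' r)).
  - intros r; split.
    + intros (x & _ & y & _ & E & K); apply pair_inj in E as [-> ->]; exact K.
    + intros K; exists (t r); split; [apply le_pair_l |].
      exists (u r); split; [apply le_pair_r |]; auto.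
  - apply (D0_app3 (fun w z z' => exists x, x < w + 1 /\ exists y, y < w + 1 /\
      w = pair x y /\ P x y z z')); [| apply T0_pair; trivial | trivial | trivial].
    repeat def_step.
    apply (D0_subst _ (fun k => match k with
      O => inl 1 | 1 => inl 0 | 2 => inl 3 | _ => inl 4 end%nat) H).
Qed.


Create HintDb definable.

Ltac rel_step := cbv beta; match goal with
  | |- D0 (fun r => ?R (@?a r) (@?b r) (@?c r) (@?d r)) =>
      apply (D0_app4 R a b c d); [solve [trivial with definable] | term | term | term | term]
  | |- D0 (fun r => ?R (@?a r) (@?b r) (@?c r)) =>
      apply (D0_app3 R a b c); [solve [trivial with definable] | term | term | term]
  | |- D0 (fun r => ?R (@?a r) (@?b r)) =>
      apply (D0_app2 R a b); [solve [trivial with definable] | term | term]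
  | |- D0 (fun r => ?R (@?a r)) =>
      apply (D0_app1 R a); [solve [trivial with definable] | term]
  end.

Ltac definable := solve [repeat first [rel_step | def_step]].

(** * Least and greatest elements, and Delta^0_1 comprehension *)

Lemma least (P : M -> Prop) : D0 (fun r => P (r 0%nat)) ->
  (exists x, P x) -> exists x, P x /\ forall y, y < x -> ~ P y.
Proof.
  intros HP (x & Hx); apply NNPP; intros N.
  assert (A : forall x y, y < x -> ~ P y).
  { apply (Delta0_ind (fun x => forall y, y < x -> ~ P y)); [definable | |].
    - intros y Hy; destruct (lt_not0 _ Hy).
    - intros u IH y Hy Py; apply le_cases in Hy as [Hy | ->]; [exact (IH _ Hy Py) |].
      apply N; exists u; auto. }
  exact (A _ _ (lt_succ x) Hx).
Qed.

Lemma greatest (P : M -> Prop) B : D0 (fun r => P (r 0%nat)) ->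
  (exists x, P x) -> (forall x, P x -> x < B) ->
  exists x, P x /\ forall y, x < y -> ~ P y.
Proof.
  intros HP (x & Hx) HB.
  destruct (least (fun u => forall y, y < B -> P y -> y < u)) as (u & Hu & Hl);
    [definable | eauto |].
  destruct (zero_or_succ u) as [-> | [v ->]].
  - destruct (lt_not0 _ (Hu _ (HB _ Hx) Hx)).
  - assert (A : forall y, v < y -> ~ P y).
    { intros y Hy Py; refine (proj2 (not_lt _ _) _ (Hu _ (HB _ Py) Py)).
      destruct (lt_elim _ _ Hy) as [w ->]; apply (lt_intro _ _ w); ring. }
    exists v; split; trivial.
    apply NNPP; intros N; apply (Hl _ (lt_succ v)).
    intros y _ Py; destruct (lt_total y v) as [K | [-> | K]]; trivial.
    + contradiction.
    + destruct (A _ K Py).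
Qed.

Lemma Delta1_comprehension (P Q : M -> M -> Prop) :
  D0 (fun r => P (r 0%nat) (r 1%nat)) -> D0 (fun r => Q (r 0%nat) (r 1%nat)) ->
  (forall x, (exists m, P x m) <-> forall m, Q x m) ->
  D0 (fun r => exists m, P (r 0%nat) m).
Proof.
  intros HP HQ E.
  assert (HP' : D0 (fun r => P (r 1%nat) (r 0%nat))) by definable.
  assert (HQ' : D0 (fun r => Q (r 1%nat) (r 0%nat))) by definable.
  destruct (D0_forms4 _ _ HP' HQ') as (p & q & rho & Hp & Hq & F).
  pose proof (rca_Delta1_CA HM : Delta1_CA M) as CA.
  assert (EP : forall x, (exists m, P x m) <-> sat (x .: 0 .: 0 .: rho) (fEx p)).
  { intros x; simpl; split; intros [m Hm]; exists m; apply (F m x 0 0), Hm. }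
  assert (EQ : forall x, (forall m, Q x m) <-> sat (x .: 0 .: 0 .: rho) (fAll q)).
  { intros x; simpl; split; intros Hm m; apply (F m x 0 0), Hm. }
  destruct (CA (fEx p) (fAll q) (0 .: 0 .: rho)) as (X & HX & EX).
  - apply Sigma_Ex, Sigma_Pi, Pi_Delta0, Hp.
  - apply Pi_All, Pi_Sigma, Sigma_Delta0, Hq.
  - intros x; rewrite <- EP, <- EQ; apply E.
  - apply D0_ext with (fun r => X (r 0%nat)); [| apply D0_set; [trivial | term]].
    intros r; rewrite EX, EP; reflexivity.
Qed.

Lemma Delta1_comprehension2 (P Q : M -> M -> M -> Prop) :
  D0 (fun r => P (r 0%nat) (r 1%nat) (r 2%nat)) ->
  D0 (fun r => Q (r 0%nat) (r 1%nat) (r 2%nat)) ->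
  (forall x y, (exists m, P x y m) <-> forall m, Q x y m) ->
  D0 (fun r => exists m, P (r 0%nat) (r 1%nat) m).
Proof.
  intros HP HQ E.
  pose (code := fun (R : M -> M -> M -> Prop) w m =>
    exists x, x < w + 1 /\ exists y, y < w + 1 /\ w = pair x y /\ R x y m).
  assert (C : forall R x y m, code R (pair x y) m <-> R x y m).
  { intros R x y m; unfold code; split.
    - intros (x' & _ & y' & _ & F & K); apply pair_inj in F as [-> ->]; exact K.
    - intros K; exists x; split; [apply le_pair_l |].
      exists y; split; [apply le_pair_r |]; auto. }
  assert (H : D0 (fun r => exists m, code P (r 0%nat) m)).
  { apply (Delta1_comprehension (code P) (code Q)); [unfold code; definable.. |].
    intros w; split.
    - intros (m & x & Hx & y & Hy & -> & K) m'.
      apply C; revert m'; apply E; eauto.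
    - intros K; destruct (K 0) as (x & _ & y & _ & -> & _).
      destruct (proj2 (E x y)) as [m Hm]; [intros m; apply C, K | exists m; apply C, Hm]. }
  apply D0_ext with (fun r => exists m, code P (pair (r 0%nat) (r 1%nat)) m).
  - intros r; setoid_rewrite C; reflexivity.
  - apply (D0_app1 (fun w => exists m, code P w m)); [trivial | term].
Qed.

Lemma le_mul_pos (q m : M) : 0 < m -> q < q * m + 1.
Proof.
  intros H; destruct (lt_elim _ _ H) as [z ->]; apply (lt_intro _ _ (q * z)); ring.
Qed.

Lemma le_add_l (x y : M) : x < x + y + 1.
Proof. apply (lt_intro _ _ y); ring. Qed.

Lemma le_add_r (x y : M) : y < x + y + 1.
Proof. apply (lt_intro _ _ x); ring. Qed.

Lemma lt_pos (x y : M) : x < y -> 0 < y.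
Proof. intros H; destruct (lt_elim _ _ H) as [z ->]; apply (lt_intro _ _ (x + z)); ring. Qed.

(** * Exponentiation and codes of finite sets *)

Lemma beta_unique (c d i v v' : M) : beta c d i v -> beta c d i v' -> v = v'.
Proof.
  intros (H & q & E) (H' & q' & E'); rewrite E in E'.
  exact (proj2 (euclid_unique _ _ _ _ _ H H' E')).
Qed.

Lemma beta_le (c d i v : M) : beta c d i v -> v < c + 1.
Proof. intros (H & q & ->); apply le_add_r. Qed.

Lemma D0_beta : D0 (fun r => beta (r 0%nat) (r 1%nat) (r 2%nat) (r 3%nat)).
Proof.
  apply D0_ext with (fun r => r 3%nat < 1 + (r 2%nat + 1) * r 1%nat /\
    exists q, q < r 0%nat + 1 /\ r 0%nat = q * (1 + (r 2%nat + 1) * r 1%nat) + r 3%nat);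
    [| definable].
  intros r; unfold beta; split.
  - intros (H & q & _ & E); eauto.
  - intros (H & q & E); split; trivial; exists q; split; trivial.
    rewrite E; apply le_trans with (q * (1 + (r 2%nat + 1) * r 1%nat)).
    + apply le_mul_pos, (lt_pos _ _ H).
    + apply le_add_l.
Qed.
Hint Resolve D0_beta : definable.

(** Induction along the two coded sequences. Values of [beta] do not exceed the code, so the
    compared values can be quantified below [c + 1] and [c' + 1], which keeps the induction
    Delta^0_0. *)
Lemma is_pow_unique (a x y y' : M) : is_pow a x y -> is_pow a x y' -> y = y'.
Proof.
  intros (c & d & H0 & HS & H) (c' & d' & H0' & HS' & H').
  assert (A : forall i, i < x + 1 -> forall v, v < c + 1 -> forall v', v' < c' + 1 ->
    beta c d i v -> beta c' d' i v' -> v = v').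
  { apply (Delta0_ind (fun i => i < x + 1 -> forall v, v < c + 1 -> forall v', v' < c' + 1 ->
      beta c d i v -> beta c' d' i v' -> v = v')); [definable | |].
    - intros _ v _ v' _ B B'.
      rewrite (beta_unique _ _ _ _ _ B H0), (beta_unique _ _ _ _ _ B' H0'); reflexivity.
    - intros i IH Hi v _ v' _ B B'.
      assert (Hi' : i < x) by exact (add_lt_cancel _ _ _ Hi).
      destruct (HS _ Hi') as (u & Bu & Bu1), (HS' _ Hi') as (u' & Bu' & Bu1').
      rewrite (beta_unique _ _ _ _ _ B Bu1), (beta_unique _ _ _ _ _ B' Bu1').
      f_equal; apply IH; eauto using beta_le, lt_le. }
  apply (A x); eauto using beta_le, le_refl.
Qed.

Lemma is_pow_zero (a : M) : is_pow a 0 1.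
Proof.
  destruct (rca_exp HM a 0) as (y & c & d & H0 & HS & H); exists c, d; auto.
Qed.

(** No code is extended: the code that totality gives for [x + 1] also yields a value at [x], and
    uniqueness identifies it with [y]. *)
Lemma is_pow_succ (a x y : M) : is_pow a x y -> is_pow a (x + 1) (a * y).
Proof.
  intros Hy; destruct (rca_exp HM a (x + 1)) as (y' & c & d & H0 & HS & H).
  destruct (HS x (lt_succ x)) as (v & Bv & Bv').
  assert (Hv : is_pow a x v) by (exists c, d; eauto using lt_le).
  rewrite (is_pow_unique _ _ _ _ Hy Hv); exists c, d; auto.
Qed.

(** The graph is Sigma^0_1 by definition and also Pi^0_1: by totality and uniqueness, [y] is the
    value iff no other value is ever found. In [Q] the number [m] bounds the code. *)
Lemma D0_is_pow (a : M) : D0 (fun r => is_pow a (r 0%nat) (r 1%nat)).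
Proof.
  pose (Q := fun x y m => exists c, c < m /\ exists d, d < m /\ beta c d 0 1 /\
    (forall i, i < x -> exists v, v < c + 1 /\ beta c d i v /\ beta c d (i + 1) (a * v)) /\
    beta c d x y).
  assert (E : forall x y, (exists m, Q x y m) <-> is_pow a x y).
  { intros x y; split.
    - intros (m & c & _ & d & _ & H0 & HS & H); exists c, d; split; [| split]; trivial.
      intros i Hi; destruct (HS i Hi) as (v & _ & K); eauto.
    - intros (c & d & H0 & HS & H); exists (c + d + 1), c; split; [apply le_add_l |].
      exists d; split; [apply le_add_r |]; split; [| split]; trivial.
      intros i Hi; destruct (HS i Hi) as (v & K & K'); eauto using beta_le. }
  assert (HQ : D0 (fun r => Q (r 0%nat) (r 1%nat) (r 2%nat))) by (unfold Q; definable).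
  apply D0_ext with (fun r => exists m, Q (r 0%nat) (r 1%nat) m); [intros; apply E |].
  apply (Delta1_comprehension2 Q (fun x y m => forall y', y' < m -> Q x y' m -> y' = y));
    [trivial | definable |].
  intros x y; rewrite E; split.
  - intros H m y' _ K; apply (is_pow_unique a x); trivial; apply E; eauto.
  - intros H; destruct (rca_exp HM a x) as [z Hz].
    destruct (proj2 (E x z) Hz) as [m Hm].
    rewrite <- (H (m + z + 1) z); trivial; [apply le_add_r |].
    destruct Hm as (c & Hc & d & Hd & K).
    exists c; split; [exact (lt_trans _ _ _ Hc (le_add_l _ _)) |].
    exists d; split; [exact (lt_trans _ _ _ Hd (le_add_l _ _)) |]; exact K.
Qed.
Hint Resolve D0_is_pow : definable.

(** * Powers of two and binary digits *)

Lemma pow2_succ (u p : M) : is_pow (1 + 1) u p -> is_pow (1 + 1) (u + 1) (p + p).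
Proof. intros H; apply is_pow_succ in H; replace (p + p) with ((1 + 1) * p) by ring; exact H. Qed.

Lemma pow2_pred (u p : M) : is_pow (1 + 1) (u + 1) p ->
  exists q, is_pow (1 + 1) u q /\ p = q + q.
Proof.
  intros H; destruct (rca_exp HM (1 + 1) u) as [q Hq]; exists q; split; trivial.
  exact (is_pow_unique _ _ _ _ H (pow2_succ _ _ Hq)).
Qed.

(** Quantifying over powers [q] up to the fixed power [p] keeps the induction Delta^0_0, and halving
    [q] respects that bound. The later inductions on exponents use the same device. *)
Lemma pow2_gt (u p : M) : is_pow (1 + 1) u p -> u < p.
Proof.
  intros H.
  assert (A : forall u, forall q, q < p + 1 -> is_pow (1 + 1) u q -> u < q).
  { apply (Delta0_ind (fun u => forall q, q < p + 1 -> is_pow (1 + 1) u q -> u < q));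
      [definable | |].
    - intros q _ Hq; rewrite (is_pow_unique _ _ _ _ Hq (is_pow_zero _)); apply (pa_lt01 PA).
    - intros v IH q Hq K; destruct (pow2_pred _ _ K) as (q' & K' & ->).
      assert (L : v < q') by (apply IH; trivial; exact (le_lt_trans _ _ _ (le_add_l _ _) Hq)).
      destruct (lt_elim _ _ L) as [z ->]; apply (lt_intro _ _ (v + z + z)); ring. }
  exact (A u p (le_refl p) H).
Qed.

Lemma pow2_pos (u p : M) : is_pow (1 + 1) u p -> 0 < p.
Proof. intros H; exact (lt_pos _ _ (pow2_gt _ _ H)). Qed.

(** The factor of [p] is even, so adding [b] to a number preserves the parity of its quotient by
    [p], that is, its [u]-th digit. *)
Lemma pow2_split (u v p b : M) : is_pow (1 + 1) u p -> is_pow (1 + 1) v b -> u < v ->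
  exists k, b = (k + k) * p.
Proof.
  intros Hp Hb H; destruct (lt_elim _ _ H) as [w ->].
  assert (A : forall w, forall c, c < b + 1 -> is_pow (1 + 1) (u + w + 1) c ->
    exists k, k < c + 1 /\ c = (k + k) * p).
  { apply (Delta0_ind (fun w => forall c, c < b + 1 -> is_pow (1 + 1) (u + w + 1) c ->
      exists k, k < c + 1 /\ c = (k + k) * p)); [definable | |].
    - intros c _ Hc; replace (u + 0) with u in Hc by ring.
      destruct (pow2_pred _ _ Hc) as (q & Hq & ->).
      rewrite (is_pow_unique _ _ _ _ Hq Hp); exists 1; split; [| ring].
      destruct (lt_elim _ _ (pow2_pos _ _ Hp)) as [z ->].
      apply (lt_intro _ _ (z + z + 1)); ring.
    - intros x IH c Hc K; replace (u + (x + 1)) with (u + x + 1) in K by ring.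
      destruct (pow2_pred _ _ K) as (q & Hq & ->).
      destruct (IH q) as (k & Hk & E); trivial.
      { exact (le_lt_trans _ _ _ (le_add_l _ _) Hc). }
      exists (k + k); split; [| rewrite E; ring].
      apply le_cases in Hk as [Hk | ->]; [| apply le_refl].
      apply lt_le.
      apply lt_trans with (k + k + 1); [apply lt_succ | apply lt_add; trivial]. }
  destruct (A w b (le_refl b) Hb) as (k & _ & E); eauto.
Qed.

Lemma euclid (m c : M) : 0 < m -> exists q r, r < m /\ c = q * m + r.
Proof.
  intros Hm.
  assert (A : forall c, exists q, q < c + 1 /\ exists r, r < m /\ c = q * m + r).
  { apply (Delta0_ind (fun c => exists q, q < c + 1 /\ exists r, r < m /\ c = q * m + r));
      [definable | |].
    - exists 0; split; [apply lt_succ |]; exists 0; split; trivial; ring.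
    - intros x (q & Hq & r & Hr & E).
      destruct (lt_elim _ _ Hr) as [z Hz].
      destruct (zero_or_succ z) as [-> | [w ->]].
      + exists (q + 1); split; [apply lt_add_r, Hq |].
        exists 0; split; trivial; rewrite E, Hz; ring.
      + exists q; split; [apply lt_le, Hq |].
        exists (r + 1); split; [apply (lt_intro _ _ w); rewrite Hz; ring | rewrite E; ring]. }
  destruct (A c) as (q & _ & r & K & E); eauto.
Qed.

Lemma even_or_odd (x : M) : exists k, x = k + k \/ x = k + k + 1.
Proof.
  destruct (euclid (1 + 1) x) as (k & r & Hr & ->); [apply (lt_intro _ _ 1); ring |].
  exists k; apply le_cases in Hr as [Hr | ->]; [left | right; ring].
  destruct (zero_or_succ r) as [-> | [s ->]]; [ring |].
  destruct (lt_not0 s); apply (add_lt_cancel _ _ 1).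
  replace ((0 : M) + 1) with (1 : M) by ring; exact Hr.
Qed.

Lemma even_not_odd (k l : M) : k + k <> l + l + 1.
Proof.
  intros E; destruct (euclid_unique (1 + 1) k l 0 1) as [_ K].
  - apply (lt_intro _ _ 1); ring.
  - apply lt_succ.
  - replace (k * (1 + 1) + 0) with (k + k) by ring; rewrite E; ring.
  - apply (lt_irrefl 0); rewrite K at 2; apply (pa_lt01 PA).
Qed.

Lemma in_code_intro (u p q r : M) : is_pow (1 + 1) u p -> r < p ->
  in_code u ((q + q + 1) * p + r).
Proof. intros; exists p, q, r; auto. Qed.

Lemma not_in_code_intro (u p q r : M) : is_pow (1 + 1) u p -> r < p ->
  ~ in_code u ((q + q) * p + r).
Proof.
  intros Hp Hr (p' & q' & r' & Hp' & Hr' & E).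
  rewrite <- (is_pow_unique _ _ _ _ Hp Hp') in *.
  destruct (euclid_unique _ _ _ _ _ Hr Hr' E) as [K _]; exact (even_not_odd _ _ K).
Qed.

Lemma in_code_lt (u c : M) : in_code u c -> u < c.
Proof.
  intros (p & q & r & Hp & _ & ->).
  apply lt_le_trans with p; [exact (pow2_gt _ _ Hp) |].
  apply (lt_intro _ _ ((q + q) * p + r)); ring.
Qed.

Lemma D0_in_code : D0 (fun r => in_code (r 0%nat) (r 1%nat)).
Proof.
  apply D0_ext with (fun e => exists p, p < e 1%nat + 1 /\ exists q, q < e 1%nat + 1 /\
    exists r, r < e 1%nat + 1 /\ is_pow (1 + 1) (e 0%nat) p /\ r < p /\
      e 1%nat = ((q + q) + 1) * p + r); [| definable].
  intros e; split.
  - intros (p & _ & q & _ & r & _ & H); exists p, q, r; exact H.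
  - intros (p & q & r & Hp & Hr & E).
    destruct (lt_elim _ _ (pow2_pos _ _ Hp)) as [z Hz].
    exists p; split; [| exists q; split; [| exists r; split; [| auto]]]; rewrite E, ?Hz.
    + apply (lt_intro _ _ ((q + q) * (0 + z + 1) + r)); ring.
    + apply (lt_intro _ _ (q + (q + q) * z + z + 1 + r)); ring.
    + apply le_add_r.
Qed.
Hint Resolve D0_in_code : definable.

Lemma in_code_add (u v p b c : M) : is_pow (1 + 1) u p -> is_pow (1 + 1) v b -> u < v ->
  in_code u (c + b) <-> in_code u c.
Proof.
  intros Hp Hb H; destruct (pow2_split _ _ _ _ Hp Hb H) as [k ->].
  destruct (euclid p c (pow2_pos _ _ Hp)) as (q & r & Hr & ->).
  destruct (even_or_odd q) as (l & [-> | ->]).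
  - replace ((l + l) * p + r + (k + k) * p) with (((l + k) + (l + k)) * p + r) by ring.
    split; intros K; [destruct (not_in_code_intro u p (l + k) r) |
                      destruct (not_in_code_intro u p l r)]; trivial.
  - replace ((l + l + 1) * p + r + (k + k) * p)
      with (((l + k) + (l + k) + 1) * p + r) by ring.
    split; intros _; apply in_code_intro; trivial.
Qed.

(** The code is built digit by digit, the part of [X] below v having a code below 2^v. The power 2^B
    bounds all these codes, so totality of exponentiation makes the induction Delta^0_0. *)
Lemma finite_code (X : M -> Prop) (B : M) : D0 (fun r => X (r 0%nat)) ->
  (forall u, X u -> u < B) -> exists c, forall u, in_code u c <-> X u.
Proof.
  intros HX HB; destruct (rca_exp HM (1 + 1) B) as [N HN].
  assert (A : forall v, forall b, b < N + 1 -> is_pow (1 + 1) v b ->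
    exists c, c < b /\ forall u, u < v -> (in_code u c <-> X u)).
  { apply (Delta0_ind (fun v => forall b, b < N + 1 -> is_pow (1 + 1) v b ->
      exists c, c < b /\ forall u, u < v -> (in_code u c <-> X u))); [definable | |].
    - intros b _ Hb; exists 0; split; [exact (pow2_pos _ _ Hb) |].
      intros u Hu; destruct (lt_not0 _ Hu).
    - intros v IH b Hb K; destruct (pow2_pred _ _ K) as (q & Hq & ->).
      destruct (IH q) as (c & Hc & E); trivial.
      { exact (le_lt_trans _ _ _ (le_add_l _ _) Hb). }
      destruct (classic (X v)) as [Xv | Xv].
      + exists (c + q); split; [apply lt_add_r, Hc |].
        intros u Hu; apply le_cases in Hu as [Hu | ->].
        * destruct (rca_exp HM (1 + 1) u) as [p Hp].
          rewrite (in_code_add _ _ _ _ _ Hp Hq Hu); auto.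
        * replace (c + q) with ((0 + 0 + 1) * q + c) by ring.
          split; intros _; [trivial | apply in_code_intro; trivial].
      + exists c; split; [exact (lt_le_trans _ _ _ Hc (le_add_l _ _)) |].
        intros u Hu; apply le_cases in Hu as [Hu | ->]; [auto |].
        replace c with ((0 + 0) * q + c) by ring.
        split; intros K'; [destruct (not_in_code_intro v q 0 c) | contradiction]; trivial. }
  destruct (A B N (le_refl N) HN) as (c & Hc & E).
  exists c; intros u; destruct (classic (u < B)) as [Hu | Hu]; [auto |].
  split; [| intros K; destruct (Hu (HB _ K))].
  intros K; exfalso; apply not_lt, le_cases in Hu.
  destruct (rca_exp HM (1 + 1) u) as [p Hp].
  (* For [u] from [B] on, the code is below 2^u, so its quotient by 2^u is 0 and so is the [u]-th
     digit. *)
  assert (Hcp : c < p).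
  { destruct Hu as [Hu | ->].
    - destruct (pow2_split _ _ _ _ HN Hp Hu) as [k Ek].
      destruct (zero_or_succ k) as [-> | [l ->]].
      + exfalso; apply (lt_irrefl 0); pose proof (pow2_pos _ _ Hp) as P0.
        rewrite Ek in P0; replace ((0 + 0) * N) with (0 : M) in P0 by ring; exact P0.
      + apply lt_le_trans with (1 := Hc); rewrite Ek.
        apply (lt_intro _ _ ((l + l + 1) * N)); ring.
    - rewrite (is_pow_unique _ _ _ _ Hp HN); exact Hc. }
  apply (not_in_code_intro u p 0 c); trivial.
  replace ((0 + 0) * p + c) with c by ring; exact K.
Qed.

Lemma succ_neq_0 (x : M) : x + 1 <> 0.
Proof.
  intros E; apply (lt_not0 x); rewrite <- E; apply lt_succ.
Qed.

Lemma num_inj (j k : nat) : num M j = num M k -> j = k.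
Proof.
  revert k; induction j as [|j IH]; intros [|k] E; simpl in E; trivial.
  - destruct (succ_neq_0 _ (eq_sym E)).
  - destruct (succ_neq_0 _ E).
  - f_equal; apply IH, (add_cancel _ _ 1), E.
Qed.

Lemma le_elim (x y : M) : x < y + 1 -> exists z, y = x + z.
Proof.
  intros H; apply le_cases in H as [H | ->].
  - destruct (lt_elim _ _ H) as [z ->]; exists (z + 1); ring.
  - exists 0; ring.
Qed.

Lemma pair_le (x y x' y' : M) : x < x' + 1 -> y < y' + 1 -> pair x y < pair x' y' + 1.
Proof.
  intros Hx Hy; destruct (le_elim _ _ Hx) as [a ->], (le_elim _ _ Hy) as [b ->].
  apply (lt_intro _ _ ((x + y) * (a + b) * (1 + 1) + (a + b) * (a + b) + a)).
  unfold pair; ring.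
Qed.


(** * The search program *)

Ltac invert_justified H :=
  match type of H with
  | justified _ _ ?e _ _ =>
      let e' := fresh in let E := fresh "E" in
      remember e as e' eqn:E; destruct H;
      apply pair_inj in E as [E ?]; apply num_inj in E; try discriminate E; clear E
  end.

Section Inversion.
Variables (A : M -> Prop) (D : M -> M -> M -> Prop).

Lemma justified_const c a v : justified A D (pair (num M 0) c) a v -> v = c.
Proof. intros H; invert_justified H; trivial. Qed.

Lemma justified_id a v : justified A D (pair (num M 1) 0) a v -> v = a.
Proof. intros H; invert_justified H; trivial. Qed.

Lemma justified_oracle a v : justified A D (pair (num M 7) 0) a v -> v = 0 -> ~ A a.
Proof.
  intros H; invert_justified H; trivial.
  intros E; exfalso; apply (lt_irrefl (0 : M)); rewrite <- E at 2; apply (pa_lt01 PA).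
Qed.

Lemma justified_comp e1 e2 a v : justified A D (pair (num M 8) (pair e1 e2)) a v ->
  exists b, D e2 a b /\ D e1 b v.
Proof.
  intros H; invert_justified H.
  match goal with E : pair _ _ = pair _ _ |- _ => apply pair_inj in E as [-> ->] end.
  eauto.
Qed.

Lemma justified_pair e1 e2 a v : justified A D (pair (num M 9) (pair e1 e2)) a v ->
  exists u w, v = pair u w /\ D e1 a u /\ D e2 a w.
Proof.
  intros H; invert_justified H.
  match goal with E : pair _ _ = pair _ _ |- _ => apply pair_inj in E as [-> ->] end.
  eauto.
Qed.

Lemma justified_mu e a v : justified A D (pair (num M 10) e) a v -> D e (pair a v) 0.
Proof. intros H; invert_justified H; subst; trivial. Qed.

End Inversion.

Definition oracle_index : M := pair (num M 7) 0.
(** An index of [x |-> pair i x]. The number [i] sits in it as a constant function, so [search]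
    depends on [i] by an explicit polynomial and no general parameter theorem is invoked. *)
Definition pairing_index (i : M) : M :=
  pair (num M 9) (pair (pair (num M 0) i) (pair (num M 1) 0)).

(* The program [x |-> mu t, A (pair (pair i x) t) = 0]. *)
Definition search (i : M) : M :=
  pair (num M 8) (pair (pair (num M 10) oracle_index) (pairing_index i)).

(** Tracing a fixed number of claims back from the result leads to an oracle query answered 0; no
    induction on the computation is involved. *)
Lemma search_sound (A : M -> Prop) (i x : M) :
  W A (search i) x -> exists t, ~ A (pair (pair i x) t).
Proof.
  intros (s & c & v & _ & Hc & H).
  destruct (justified_comp _ _ _ _ _ _ (Hc _ _ _ H)) as (b & H2 & H1).
  destruct (justified_pair _ _ _ _ _ _ (Hc _ _ _ H2)) as (u & w & -> & Hu & Hw).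
  rewrite (justified_const _ _ _ _ _ (Hc _ _ _ Hu)) in *.
  rewrite (justified_id _ _ _ _ (Hc _ _ _ Hw)) in *.
  exists v; apply (justified_oracle _ _ _ _ (Hc _ _ _ (justified_mu _ _ _ _ _ (Hc _ _ _ H1))));
    reflexivity.
Qed.

(** The least successful [t] exists because [A] is definable. The computation consists of five
    claims about the composite program and one oracle claim for each [u] up to that minimum;
    [finite_code] codes it. *)
Lemma search_complete (A : M -> Prop) (i x t : M) : D0 (fun r => A (r 0%nat)) ->
  ~ A (pair (pair i x) t) -> W A (search i) x.
Proof.
  intros HA Ht0.
  destruct (least (fun t => ~ A (pair (pair i x) t))) as (y & Hy & Hl); [definable | eauto |].
  clear t Ht0.
  pose (cl := fun e a v : M => pair e (pair a v)).
  assert (Icl : forall e a v e' a' v', cl e a v = cl e' a' v' -> e = e' /\ a = a' /\ v = v').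
  { intros e a v e' a' v' E; apply pair_inj in E as [-> E]; apply pair_inj in E as [-> ->]; auto. }
  pose (k1 := cl (pair (num M 0) i) x i).
  pose (k2 := cl (pair (num M 1) 0) x x).
  pose (k3 := cl (pairing_index i) x (pair i x)).
  pose (k4 := cl (pair (num M 10) oracle_index) (pair i x) y).
  pose (k5 := cl (search i) x y).
  (* [k6] is only a bound: as [pair] is monotone, it dominates all oracle claims for [u] up to
     [y]. *)
  pose (k6 := cl oracle_index (pair (pair i x) y) 1).
  pose (X := fun w => w = k1 \/ w = k2 \/ w = k3 \/ w = k4 \/ w = k5 \/
    exists u, u < y + 1 /\ ((u < y /\ w = cl oracle_index (pair (pair i x) u) 1) \/
                            (u = y /\ w = cl oracle_index (pair (pair i x) u) 0))).
  assert (DX : D0 (fun r => X (r 0%nat))) by (unfold X, cl; definable).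
  destruct (finite_code X (k1 + k2 + k3 + k4 + k5 + k6 + 1)) as (c & Hc); [trivial | |].
  { intros w [-> | [-> | [-> | [-> | [-> | (u & Hu & Hw)]]]]].
    - apply (lt_intro _ _ (k2 + k3 + k4 + k5 + k6)); ring.
    - apply (lt_intro _ _ (k1 + k3 + k4 + k5 + k6)); ring.
    - apply (lt_intro _ _ (k1 + k2 + k4 + k5 + k6)); ring.
    - apply (lt_intro _ _ (k1 + k2 + k3 + k5 + k6)); ring.
    - apply (lt_intro _ _ (k1 + k2 + k3 + k4 + k6)); ring.
    - assert (L : w < k6 + 1).
      { destruct Hw as [[_ ->] | [_ ->]]; repeat apply pair_le; trivial using le_refl.
        apply lt_le, (pa_lt01 PA). }
      apply (le_trans _ _ _ L); apply le_add_r. }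
  assert (HX : forall e a v, claim c e a v <-> X (cl e a v)) by (intros; apply Hc).
  exists (c + 1), c, y; split; [apply lt_succ |].
  assert (H1 : claim c (pair (num M 0) i) x i) by (apply HX; unfold X; auto).
  assert (H2 : claim c (pair (num M 1) 0) x x) by (apply HX; unfold X; auto).
  assert (H3 : claim c (pairing_index i) x (pair i x)) by (apply HX; unfold X; auto).
  assert (H4 : claim c (pair (num M 10) oracle_index) (pair i x) y)
    by (apply HX; unfold X; auto).
  assert (H5 : claim c (search i) x y) by (apply HX; unfold X; auto 6).
  split; trivial.
  intros e a v H; apply HX in H.
  destruct H as [E | [E | [E | [E | [E | (u & Hu & [[Hu' E] | [Hu' E]])]]]]];
    apply Icl in E as (-> & -> & ->).
  - apply j_const.
  - apply j_id.
  - apply j_pair; trivial.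
  - apply j_mu.
    + apply HX; unfold X; do 5 right; exists y; split; [apply le_refl | auto].
    + intros u Hu; exists 1; split.
      * intros E; apply (lt_irrefl (0 : M)); rewrite <- E at 2; apply (pa_lt01 PA).
      * apply HX; unfold X; do 5 right; exists u; split; [apply lt_le, Hu | auto].
  - apply j_comp with (pair i x); trivial.
  - apply j_oracle_in, NNPP, (Hl _ Hu').
  - subst u; apply j_oracle_out, Hy.
Qed.

Lemma computable_search : computable search.
Proof.
  assert (H : D0 (fun r => search (r 0%nat) = r 1%nat))
    by (unfold search, oracle_index, pairing_index; definable).
  destruct (D0_forms4 _ _ H H) as (p & q & rho & Hp & Hq & E).
  exists p, q, (0 .: 0 .: rho); split; [apply Sigma_Pi, Pi_Delta0, Hp |].
  split; [apply Pi_Sigma, Sigma_Delta0, Hq |].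
  intros x y; apply (E x y 0 0).
Qed.

(** The form in which (a) is applied. The oracle is the complement of [R] on coded triples, because
    [search] halts when it meets a number outside its oracle. *)
Lemma cofinite_uniform (R : M -> M -> M -> Prop) (n : M) :
  cofinite_intersections M ->
  D0 (fun r => R (r 0%nat) (r 1%nat) (r 2%nat)) ->
  (forall i, i < n -> exists k, forall s, k < s -> exists t, R i s t) ->
  exists k, forall i, i < n -> forall s, k < s -> exists t, R i s t.
Proof.
  intros CI HR H.
  destruct (Delta0_comprehension (fun w => ~ exists p, p < w + 1 /\ exists t, t < w + 1 /\
    exists i, i < p + 1 /\ exists s, s < p + 1 /\ w = pair p t /\ p = pair i s /\ R i s t))
    as (A & HA & EA); [definable |].
  assert (E : forall i s t, ~ A (pair (pair i s) t) <-> R i s t).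
  { intros i s t; rewrite EA; split.
    - intros N; apply NNPP in N.
      destruct N as (p & _ & t' & _ & i' & _ & s' & _ & Ew & Ep & K).
      apply pair_inj in Ew as [<- <-]; apply pair_inj in Ep as [<- <-]; exact K.
    - intros K N; apply N.
      exists (pair i s); split; [apply le_pair_l |]; exists t; split; [apply le_pair_r |].
      exists i; split; [apply le_pair_l |]; exists s; split; [apply le_pair_r |]; auto. }
  destruct (CI A n search HA computable_search) as [k Hk].
  - intros i Hi; destruct (H i Hi) as [k Hk]; exists k; intros s Hs.
    destruct (Hk s Hs) as [t Ht]; apply search_complete with t.
    + apply D0_set; [trivial | term].
    + apply E, Ht.
  - exists k; intros i Hi s Hs.
    destruct (search_sound _ _ _ (Hk s Hs i Hi)) as [t Ht]; exists t; apply E, Ht.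
Qed.

(** * Bounding from cofinite intersections *)

Section Bounding.
Hypothesis CI : cofinite_intersections M.

(* The family is [{s | s is not the least y with R x y}]. *)
Lemma strong_Sigma1_bounding (R : M -> M -> Prop) (n : M) :
  D0 (fun r => R (r 0%nat) (r 1%nat)) ->
  exists b, forall x, x < n -> (exists y, R x y) -> exists y, y < b /\ R x y.
Proof.
  intros HR.
  destruct (cofinite_uniform (fun i s _ => ~ (R i s /\ forall y, y < s -> ~ R i y)) n CI)
    as [b Hb]; [definable | |].
  - intros i _; destruct (classic (exists y, R i y)) as [[y Hy] | N].
    + exists y; intros s Hs; exists 0; intros [_ K]; exact (K _ Hs Hy).
    + exists 0; intros s _; exists 0; intros [K _]; eauto.
  - exists (b + 1); intros x Hx Ey.
    destruct (least (fun y => R x y)) as (y & Hy & Hl); [definable | trivial |].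
    exists y; split; trivial; apply not_lt; intros Hby.
    destruct (Hb _ Hx _ Hby) as [_ K]; apply K; auto.
Qed.

(** Strong bounding gives one [b] below which every false candidate under [z0] is refuted, so truth
    of such a candidate becomes Delta^0_0 and the least number principle applies. The disjunct
    [z = z0] covers the case that no smaller candidate is true. *)
Lemma least_Pi1 (R : M -> M -> Prop) : D0 (fun r => R (r 0%nat) (r 1%nat)) ->
  (exists z, forall x, R z x) ->
  exists z b, (forall x, R z x) /\ forall z', z' < z -> exists x, x < b /\ ~ R z' x.
Proof.
  intros HR [z0 H0].
  destruct (strong_Sigma1_bounding (fun z x => ~ R z x) z0) as [b Hb]; [definable |].
  destruct (least (fun z => z = z0 \/ (z < z0 /\ forall x, x < b -> R z x)))
    as (z & Hz & Hl); [definable | eauto |].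
  exists z, b; split.
  - destruct Hz as [-> | [Hz K]]; trivial.
    intros x; apply NNPP; intros N.
    destruct (Hb z Hz) as (x' & Hx' & N'); eauto.
  - intros z' Hz'; apply NNPP; intros N; apply (Hl _ Hz'); right; split.
    + destruct Hz as [-> | [Hz _]]; [trivial | exact (lt_trans _ _ _ Hz' Hz)].
    + intros x Hx; apply NNPP; eauto.
Qed.

(* For each [i] the complement of the [i]-th set has at most one element: the
   first stage at which all numbers below the least [z] with [forall x, R i z x]
   have been refuted. *)
Lemma strong_Sigma2_bounding (R : M -> M -> M -> Prop) (n : M) :
  D0 (fun r => R (r 0%nat) (r 1%nat) (r 2%nat)) ->
  exists b, forall i, i < n -> (exists z, forall x, R i z x) ->
    exists z, z < b /\ forall x, R i z x.
Proof.
  intros HR.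
  (* By stage [s] all numbers below [z] are refuted. The clause [z < s + 1] lets a bound on stages
     bound [z]. *)
  pose (G := fun i z s => z < s + 1 /\ forall z', z' < z -> exists x, x < s /\ ~ R i z' x).
  assert (HG : D0 (fun r => G (r 0%nat) (r 1%nat) (r 2%nat))) by (unfold G; definable).
  pose (first := fun i z s => G i z s /\ forall s', s' < s -> ~ G i z s').
  assert (Hfirst : D0 (fun r => first (r 0%nat) (r 1%nat) (r 2%nat)))
    by (unfold first; definable).
  pose (Q := fun i s t => forall z, z < s + 1 -> first i z s -> exists x, x < t /\ ~ R i z x).
  (* The removed stages are those that are [first] for a true [z]. Merging the separate refutations
     into one [t] takes strong Sigma^0_1 bounding over [z] up to [s]. *)
  assert (NQ : forall i s, (~ exists t, Q i s t) <->
    exists z, first i z s /\ forall x, R i z x).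
  { intros i s; split.
    - intros N; apply NNPP; intros K; apply N.
      destruct (strong_Sigma1_bounding (fun z x => ~ R i z x) (s + 1)) as [t Ht];
        [definable |].
      exists t; intros z Hz Hf; apply Ht; trivial.
      apply NNPP; intros K'; apply K; exists z; split; trivial.
      intros x; apply NNPP; eauto.
    - intros (z & Hf & Hz) [t Ht].
      destruct (Ht z (proj1 (proj1 Hf)) Hf) as (x & _ & K); exact (K (Hz x)). }
  (* A true number all of whose predecessors are refuted is the least true one, so [z] is unique,
     and then its first stage. *)
  assert (U : forall i s z s' z', first i z s -> first i z' s' ->
    (forall x, R i z x) -> (forall x, R i z' x) -> s < s' -> False).
  { intros i s z s' z' [F _] [F' N] Hz Hz' Hs.
    destruct (lt_total z z') as [L | [-> | L]].
    - destruct (proj2 F' _ L) as (x & _ & K); exact (K (Hz x)).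
    - exact (N _ Hs F).
    - destruct (proj2 F _ L) as (x & _ & K); exact (K (Hz' x)). }
  destruct (cofinite_uniform Q n CI) as [b Hb]; [unfold Q; definable | |].
  - intros i _; destruct (classic (exists s, ~ exists t, Q i s t)) as [[s Hs] | N].
    + exists s; intros s' Hs'; apply NNPP; intros Hs''.
      apply NQ in Hs as (z & F & Hz); apply NQ in Hs'' as (z' & F' & Hz').
      exact (U _ _ _ _ _ F F' Hz Hz' Hs').
    + exists 0; intros s _; apply NNPP; eauto.
  - exists (b + 1); intros i Hi Ez.
    destruct (least_Pi1 (fun z x => R i z x)) as (z & c & Hz & Hc); [definable | trivial |].
    destruct (least (fun s => G i z s)) as (s & Hs & Hl); [definable | |].
    + exists (z + c); split; [apply le_add_l |].
      intros z' Hz'; destruct (Hc _ Hz') as (x & Hx & K); exists x; split; trivial.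
      exact (lt_le_trans _ _ _ Hx (le_add_r _ _)).
    + assert (Hbs : s < b + 1).
      { apply not_lt; intros K; apply (proj2 (NQ i s)); [| exact (Hb i Hi s K)].
        exists z; split; [split |]; trivial. }
      exists z; split; trivial; exact (le_trans _ _ _ (proj1 Hs) Hbs).
Qed.

(** As for [least_Pi1], with two bounds: [b] for the [x] at which false candidates fail, then [c]
    for the witnesses [y] of all true instances with [z] below [z0] and [x] below [b]. Truth of a
    candidate below [z0] thereby becomes Delta^0_0. *)
Lemma least_Pi2 (R : M -> M -> M -> Prop) :
  D0 (fun r => R (r 0%nat) (r 1%nat) (r 2%nat)) ->
  (exists z, forall x, exists y, R z x y) ->
  exists z b, (forall x, exists y, R z x y) /\
    forall z', z' < z -> exists x, x < b /\ forall y, ~ R z' x y.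
Proof.
  intros HR [z0 H0].
  destruct (strong_Sigma2_bounding (fun z x y => ~ R z x y) z0) as [b Hb]; [definable |].
  destruct (strong_Sigma1_bounding (fun w y => exists z, z < w + 1 /\ exists x, x < w + 1 /\
    w = pair z x /\ R z x y) (pair z0 b + 1)) as [c Hc]; [definable |].
  assert (Hc' : forall z x, z < z0 -> x < b -> (exists y, R z x y) ->
    exists y, y < c /\ R z x y).
  { intros z x Hz Hx [y Hy]; destruct (Hc (pair z x)) as (y' & Hy' & z' & _ & x' & _ & E & K).
    - apply pair_le; apply lt_le; trivial.
    - exists y, z; split; [apply le_pair_l |]; exists x; split; [apply le_pair_r |]; auto.
    - apply pair_inj in E as [<- <-]; eauto. }
  destruct (least (fun z => z = z0 \/ (z < z0 /\ forall x, x < b -> exists y, y < c /\ R z x y)))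
    as (z & Hz & Hl); [definable | eauto |].
  exists z, b; split.
  - destruct Hz as [-> | [Hz K]]; trivial.
    intros x; apply NNPP; intros N.
    destruct (Hb z Hz) as (x' & Hx' & N').
    + exists x; intros y Hy; eauto.
    + destruct (K x' Hx') as (y & _ & Hy); exact (N' y Hy).
  - intros z' Hz'; apply NNPP; intros N; apply (Hl _ Hz'); right.
    assert (Hz0 : z' < z0)
      by (destruct Hz as [-> | [Hz _]]; [trivial | exact (lt_trans _ _ _ Hz' Hz)]).
    split; trivial.
    intros x Hx; apply Hc'; trivial; apply NNPP; intros K; apply N.
    exists x; split; trivial; intros y Hy; eauto.
Qed.

(* [z] acts at stage [s] if [s = z] or [s] is the first stage that verifies some
   new instance of [forall x, exists y, R i z x y].  The complement of the [i]-th
   set consists of the stages [s] at which some number acts that is smaller than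
   all numbers acting later.  If [z0] is the least true number, the last stage at
   which a number below [z0] acts is such an [s], and it is at least [z0 - 1]. *)
Lemma Pi2_bounding (R : M -> M -> M -> M -> Prop) (n : M) :
  D0 (fun r => R (r 0%nat) (r 1%nat) (r 2%nat) (r 3%nat)) ->
  (forall i, i < n -> exists z, forall x, exists y, R i z x y) ->
  exists b, forall i, i < n -> exists z, z < b /\ forall x, exists y, R i z x y.
Proof.
  intros HR H.
  (* Stage [s] verifies the instances up to [x] with witnesses up to [s]. This is monotone in [s],
     so each pair of [z] and [x] has at most one first stage. *)
  pose (L := fun i z x s => x < s + 1 /\ z < s + 1 /\
    forall x', x' < x + 1 -> exists y, y < s + 1 /\ R i z x' y).
  assert (HL : D0 (fun r => L (r 0%nat) (r 1%nat) (r 2%nat) (r 3%nat)))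
    by (unfold L; definable).
  pose (acts := fun i z s => z = s \/
    exists x, x < s + 1 /\ L i z x s /\ forall s', s' < s -> ~ L i z x s').
  assert (Hacts : D0 (fun r => acts (r 0%nat) (r 1%nat) (r 2%nat)))
    by (unfold acts; definable).
  assert (acts_le : forall i z s, acts i z s -> z < s + 1).
  { intros i z s [-> | (x & _ & (_ & K & _) & _)]; [apply le_refl | exact K]. }
  (* The first stage that verifies the instances up to [k + 1] is at least [k + 1], and [z] acts
     there; it exists since strong bounding collects the witnesses. *)
  assert (unbounded : forall i z, (forall x, exists y, R i z x y) ->
    forall k, exists s, k < s /\ acts i z s).
  { intros i z Hz k.
    destruct (strong_Sigma1_bounding (fun x y => R i z x y) (k + 1 + 1)) as [b Hb];
      [definable |].
    destruct (least (fun s => L i z (k + 1) s)) as (s & Hs & Hl); [definable | |].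
    - exists (k + 1 + z + b); split; [| split].
      + apply (lt_intro _ _ (z + b)); ring.
      + apply (lt_intro _ _ (k + 1 + b)); ring.
      + intros x Hx; destruct (Hb x Hx (Hz x)) as (y & Hy & K); exists y; split; trivial.
        apply lt_le, (lt_le_trans _ _ _ Hy); apply le_add_r.
    - assert (K : k + 1 < s + 1) by exact (proj1 Hs).
      exists s; split; [exact (add_lt_cancel _ _ _ K) |].
      right; exists (k + 1); auto. }
  (* A number below [z0] fails at some x below [b], so apart from its own stage it acts only for x
     below [b]; strong bounding over codes of pairs bounds these first verifications. *)
  assert (bounded : forall i z0 b,
    (forall z, z < z0 -> exists x, x < b /\ forall y, ~ R i z x y) ->
    exists k, forall z, z < z0 -> forall s, acts i z s -> s < k).
  { intros i z0 b Hb.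
    destruct (strong_Sigma1_bounding (fun w s => exists z, z < w + 1 /\ exists x, x < w + 1 /\
      w = pair z x /\ L i z x s) (pair z0 b + 1)) as [c Hc]; [definable |].
    exists (z0 + c); intros z Hz s [<- | (x & _ & HLs & Hmin)].
    - exact (lt_le_trans _ _ _ Hz (le_add_l _ _)).
    - assert (Hx : x < b).
      { destruct (Hb z Hz) as (x0 & Hx0 & K).
        destruct (lt_total x b) as [Hx | Hx]; trivial; exfalso.
        destruct HLs as (_ & _ & HLs); destruct (HLs x0) as (y & _ & Hy); [| exact (K y Hy)].
        destruct Hx as [-> | Hx]; apply lt_le; [trivial | exact (lt_trans _ _ _ Hx0 Hx)]. }
      destruct (Hc (pair z x)) as (s' & Hs' & z' & _ & x' & _ & E & K).
      + apply pair_le; apply lt_le; trivial.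
      + exists s, z; split; [apply le_pair_l |]; exists x; split; [apply le_pair_r |]; auto.
      + apply pair_inj in E as [<- <-].
        apply lt_le_trans with (2 := le_add_r z0 c).
        apply le_lt_trans with (2 := Hs'); apply not_lt; intros Hs; exact (Hmin _ Hs K). }
  destruct (cofinite_uniform (fun i s t => s < t /\ forall z, z < s + 1 -> acts i z s ->
    exists z', z' < z + 1 /\ acts i z' t) n CI) as [b Hb]; [definable | |].
  - intros i Hi.
    destruct (least_Pi2 (fun z x y => R i z x y)) as (z0 & c & Hz0 & Hc); [definable | auto |].
    destruct (bounded i z0 c Hc) as [k Hk]; exists k; intros s Hs.
    (* Beyond [k] no number below [z0] acts, and [z0] itself acts again later. *)
    destruct (unbounded i z0 Hz0 s) as (t & Ht & K); exists t; split; trivial.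
    intros z Hz A; exists z0; split; trivial; apply not_lt; intros Hzz.
    exact (lt_irrefl _ (lt_trans _ _ _ Hs (Hk z Hzz s A))).
  - exists (b + 1 + 1); intros i Hi.
    destruct (least_Pi2 (fun z x y => R i z x y)) as (z0 & c & Hz0 & Hc); [definable | auto |].
    exists z0; split; trivial; apply not_lt; intros Hlt.
    destruct (bounded i z0 c Hc) as [k Hk].
    (* If [z0] is at least b + 2, then z0 - 1, which is [b + 1 + w], acts at its own stage, beyond
       [b]. The last action below [z0] then also comes after [b], and membership of its stage in the
       set yields a still later one. *)
    destruct (lt_elim _ _ Hlt) as [w Ew].
    assert (Hp : b + 1 + w < z0) by (rewrite Ew; apply (lt_intro _ _ 0); ring).
    destruct (greatest (fun s => exists z, z < z0 /\ acts i z s) k)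
      as (s & (z & Hz & A) & Hmax); [definable | | |].
    + exists (b + 1 + w), (b + 1 + w); split; [trivial | left; reflexivity].
    + intros s (z & Hz & A); exact (Hk z Hz s A).
    + assert (Hbs : b < s).
      { apply NNPP; intros N; apply not_lt in N.
        apply (Hmax (b + 1 + w)).
        - apply (le_lt_trans _ _ _ N); apply (lt_intro _ _ w); ring.
        - exists (b + 1 + w); split; [trivial | left; reflexivity]. }
      destruct (Hb i Hi s Hbs) as (t & Ht & K).
      destruct (K z (acts_le _ _ _ A) A) as (z' & Hz' & A').
      apply (Hmax t Ht); exists z'; split; trivial; exact (le_lt_trans _ _ _ Hz' Hz).
Qed.
End Bounding.

(** * Normal forms of formulas *)

Lemma D0_reindex (Q : (nat -> M) -> Prop) (g : (nat -> M) -> nat -> M) f :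
  D0 Q -> (forall r k, g r k = interp f r k) -> D0 (fun r => Q (g r)).
Proof.
  intros HQ E; apply D0_ext with (fun r => Q (interp f r)); [| apply D0_subst, HQ].
  intros r; rewrite (functional_extensionality (g r) (interp f r) (E r)); reflexivity.
Qed.

Ltac definable_with f := repeat (cbv beta; first [def_step |
  match goal with |- D0 (fun r => ?Q (@?g r)) => apply (D0_reindex Q g f) end; [trivial |
    let k := fresh "k" in
    intros ? k; do 6 (try (destruct k as [|k]; [reflexivity |])); reflexivity]]).

Lemma Sigma1_normal (p : form (set_of M)) : Sigma 1 p ->
  exists Q, D0 Q /\ forall rho, sat rho p <-> exists y, Q (y .: rho).
Proof.
  intros H; remember 1%nat as n eqn:En.
  induction H as [| n p HP | n p _ IH]; [discriminate | |]; injection En as ->.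
  - inversion HP as [q Hq | |].
    exists (fun r => sat (fun k => r (S k)) p); split.
    + exact (D0_sat p (fun k => inl (S k)) Hq).
    + intros rho; split; [intros K; exists 0; exact K | intros [w K]; exact K].
  - destruct (IH eq_refl) as (Q & HQ & E).
    exists (fun r => exists x, x < r 0%nat /\ exists y, y < r 0%nat /\
      Q (y .: x .: fun k => r (S k))); split.
    + definable_with (fun k => match k with 0 => inl 0 | 1 => inl 1
                               | S (S k) => inl (3 + k) end%nat : nat + M).
    + intros rho; simpl; setoid_rewrite E; split.
      * intros (x & y & K); exists (x + y + 1), x; split; [apply le_add_l |].
        exists y; split; [apply le_add_r | exact K].
      * intros (w & x & _ & y & _ & K); eauto.
Qed.

Lemma Pi1_normal (p : form (set_of M)) : Pi 1 p ->
  exists Q, D0 Q /\ forall rho, sat rho p <-> forall y, Q (y .: rho).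
Proof.
  intros H; remember 1%nat as n eqn:En.
  induction H as [| n p HP | n p _ IH]; [discriminate | |]; injection En as ->.
  - inversion HP as [q Hq | |].
    exists (fun r => sat (fun k => r (S k)) p); split.
    + exact (D0_sat p (fun k => inl (S k)) Hq).
    + intros rho; split; [intros K w; exact K | intros K; exact (K 0)].
  - destruct (IH eq_refl) as (Q & HQ & E).
    exists (fun r => forall x, x < r 0%nat -> forall y, y < r 0%nat ->
      Q (y .: x .: fun k => r (S k))); split.
    + definable_with (fun k => match k with 0 => inl 0 | 1 => inl 1
                               | S (S k) => inl (3 + k) end%nat : nat + M).
    + intros rho; simpl; setoid_rewrite E; split.
      * intros K w x _ y _; apply K.
      * intros K x y; apply (K (x + y + 1)); [apply le_add_l | apply le_add_r].
Qed.

(** Universal quantifiers are merged through [pair] and not, as one level below, through a common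
    bound, which would demand one [y] for many instances at once. *)
Lemma Pi2_normal (p : form (set_of M)) : Pi 2 p ->
  exists Q, D0 Q /\ forall rho, sat rho p <-> forall x, exists y, Q (y .: x .: rho).
Proof.
  intros H; remember 2%nat as n eqn:En.
  induction H as [| n p HS | n p _ IH]; [discriminate | |]; injection En as ->.
  - destruct (Sigma1_normal _ HS) as (Q & HQ & E).
    exists (fun r => Q (r 0%nat .: fun k => r (S (S k)))); split.
    + definable_with (fun k => match k with 0 => inl 0 | S k => inl (2 + k) end%nat : nat + M).
    + intros rho; rewrite E; split; [intros K w; exact K | intros K; exact (K 0)].
  - destruct (IH eq_refl) as (Q & HQ & E).
    exists (fun r => forall u, u < r 1%nat + 1 -> forall x, x < r 1%nat + 1 ->
      r 1%nat = pair u x -> Q (r 0%nat .: x .: u .: fun k => r (S (S k)))); split.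
    + definable_with (fun k => match k with 0 => inl 2 | 1 => inl 0 | 2 => inl 1
                               | S (S (S k)) => inl (4 + k) end%nat : nat + M).
    + intros rho; simpl; setoid_rewrite E; split.
      * intros K w; destruct (classic (exists u x, w = pair u x)) as [(u & x & ->) | N].
        -- destruct (K u x) as [y Hy]; exists y.
           intros u' _ x' _ F; apply pair_inj in F as [<- <-]; exact Hy.
        (* A number that codes no pair satisfies the matrix vacuously; 0 is a default. *)
        -- exists 0; intros u _ x _ F; destruct N; eauto.
      * intros K u x; destruct (K (pair u x)) as [y Hy]; exists y.
        apply Hy; [apply le_pair_l | apply le_pair_r | reflexivity].
Qed.

Lemma Sigma3_normal (p : form (set_of M)) : Sigma 3 p ->
  exists Q, D0 Q /\
    forall rho, sat rho p <-> exists z, forall x, exists y, Q (y .: x .: z .: rho).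
Proof.
  intros H; remember 3%nat as n eqn:En.
  induction H as [| n p HP | n p _ IH]; [discriminate | |]; injection En as ->.
  - destruct (Pi2_normal _ HP) as (Q & HQ & E).
    exists (fun r => Q (r 0%nat .: r 1%nat .: fun k => r (S (S (S k))))); split.
    + definable_with (fun k => match k with 0 => inl 0 | 1 => inl 1
                               | S (S k) => inl (3 + k) end%nat : nat + M).
    + intros rho; rewrite E; split; [intros K; exists 0; exact K | intros [w K]; exact K].
  - destruct (IH eq_refl) as (Q & HQ & E).
    exists (fun r => exists u, u < r 2%nat + 1 /\ exists z, z < r 2%nat + 1 /\
      r 2%nat = pair u z /\ Q (r 0%nat .: r 1%nat .: z .: u .: fun k => r (S (S (S k))))); split.
    + definable_with (fun k => match k with 0 => inl 2 | 1 => inl 3 | 2 => inl 0 | 3 => inl 1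
                               | S (S (S (S k))) => inl (5 + k) end%nat : nat + M).
    + intros rho; simpl; setoid_rewrite E; split.
      * intros (u & z & K); exists (pair u z); intros x.
        destruct (K x) as [y Hy]; exists y, u; split; [apply le_pair_l |].
        exists z; split; [apply le_pair_r | auto].
      * intros (w & K); destruct (K 0) as (y0 & u & _ & z & _ & -> & _); exists u, z.
        intros x; destruct (K x) as (y & u' & _ & z' & _ & F & Hy).
        apply pair_inj in F as [<- <-]; eauto.
Qed.

(** * From cofinite intersections to bounding for Sigma^0_3 formulas *)

Lemma BSigma3_of_cofinite_intersections : cofinite_intersections M -> BSigma M 3.
Proof.
  intros CI p rho n Hp H.
  destruct (Sigma3_normal _ Hp) as (Q & HQ & E).
  (* [w] codes the wanted [b] together with the outermost witness [z], so a Pi^0_2 condition on [w]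
     remains, and a bound on [w] bounds [b]. *)
  pose (R := fun i w x y => exists b, b < w + 1 /\ exists z, z < w + 1 /\
    w = pair b z /\ Q (y .: x .: z .: i .: b .: rho)).
  assert (HR : D0 (fun r => R (r 0%nat) (r 1%nat) (r 2%nat) (r 3%nat))).
  { unfold R; definable_with (fun k => match k with
      0 => inl 5 | 1 => inl 4 | 2 => inl 0 | 3 => inl 2 | 4 => inl 1
      | S (S (S (S (S k)))) => inr (rho k) end%nat : nat + M). }
  destruct (Pi2_bounding CI R n HR) as [b Hb].
  - intros i Hi; destruct (H i Hi) as [b Hb]; apply E in Hb as [z Hz].
    exists (pair b z); intros x; destruct (Hz x) as [y Hy]; exists y, b.
    split; [apply le_pair_l |]; exists z; split; [apply le_pair_r | auto].
  - exists b; intros i Hi; destruct (Hb i Hi) as (w & Hw & K).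
    destruct (K 0) as (y0 & c & Hc & z & _ & -> & _); exists c.
    split; [exact (le_lt_trans _ _ _ Hc Hw) |].
    apply E; exists z; intros x; destruct (K x) as (y & c' & _ & z' & _ & F & Hy).
    apply pair_inj in F as [<- <-]; eauto.
Qed.

Lemma computable_definable (f : M -> M) : computable f ->
  D0 (fun r => f (r 0%nat) = r 1%nat).
Proof.
  intros (p & q & rho & Hp & Hq & E).
  destruct (Sigma1_normal _ Hp) as (P & HP & EP), (Pi1_normal _ Hq) as (Q & HQ & EQ).
  apply D0_ext with (fun r => exists m, P (m .: r 0%nat .: r 1%nat .: rho)).
  - intros r; rewrite <- EP; symmetry; apply E.
  - pose (g := fun k => match k with 0 => inl 2 | 1 => inl 0 | 2 => inl 1
                        | S (S (S k)) => inr (rho k) end%nat : nat + M).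
    apply (Delta1_comprehension2 (fun x y m => P (m .: x .: y .: rho))
                                 (fun x y m => Q (m .: x .: y .: rho))).
    + definable_with g.
    + definable_with g.
    + intros x y; rewrite <- EP, <- EQ, <- (proj1 (E x y)); apply E.
Qed.

(** * Complexity of the stage approximation *)

Lemma D0_claim : D0 (fun r => claim (r 0%nat) (r 1%nat) (r 2%nat) (r 3%nat)).
Proof. unfold claim; definable. Qed.
Hint Resolve D0_claim : definable.

Lemma claim_le (c e a v : M) : claim c e a v -> e < c + 1 /\ a < c + 1 /\ v < c + 1.
Proof.
  intros H; apply in_code_lt in H.
  assert (K : pair a v < c) by exact (le_lt_trans _ _ _ (le_pair_r _ _) H).
  split; [| split]; apply lt_le.
  - exact (le_lt_trans _ _ _ (le_pair_l _ _) H).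
  - exact (le_lt_trans _ _ _ (le_pair_l _ _) K).
  - exact (le_lt_trans _ _ _ (le_pair_r _ _) K).
Qed.

(** No clause of [justified] refers to [justified] itself, so the predicate is a finite disjunction.
    Subindices are bounded by [e], and intermediate values by [c], since they occur in claims. *)
Lemma D0_justified (A : M -> Prop) : D0 (fun r => A (r 0%nat)) ->
  D0 (fun r => justified A (claim (r 0%nat)) (r 1%nat) (r 2%nat) (r 3%nat)).
Proof.
  intros HA.
  pose (binary := fun k (P : M -> M -> M -> Prop) e a v => e = pair (num M k) 0 /\
    exists x, x < a + 1 /\ exists y, y < a + 1 /\ a = pair x y /\ P x y v).
  pose (J := fun c e a v =>
    e = pair (num M 0) v \/ (e = pair (num M 1) 0 /\ v = a) \/
    binary 2%nat (fun x y v => v = x) e a v \/ binary 3%nat (fun x y v => v = y) e a v \/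
    binary 4%nat (fun x y v => v = x + y) e a v \/ binary 5%nat (fun x y v => v = x * y) e a v \/
    binary 6%nat (fun x y v => (x < y /\ v = 1) \/ (~ x < y /\ v = 0)) e a v \/
    (e = pair (num M 7) 0 /\ ((A a /\ v = 1) \/ (~ A a /\ v = 0))) \/
    (exists e1, e1 < e + 1 /\ exists e2, e2 < e + 1 /\ exists b, b < c + 1 /\
      e = pair (num M 8) (pair e1 e2) /\ claim c e2 a b /\ claim c e1 b v) \/
    (exists e1, e1 < e + 1 /\ exists e2, e2 < e + 1 /\
      exists u, u < c + 1 /\ exists w, w < c + 1 /\
      e = pair (num M 9) (pair e1 e2) /\ v = pair u w /\ claim c e1 a u /\ claim c e2 a w) \/
    (exists e', e' < e + 1 /\ e = pair (num M 10) e' /\ claim c e' (pair a v) 0 /\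
      forall u, u < v -> exists w, w < c + 1 /\ w <> 0 /\ claim c e' (pair a u) w)).
  apply D0_ext with (fun r => J (r 0%nat) (r 1%nat) (r 2%nat) (r 3%nat));
    [| unfold J, binary; definable].
  intros r; generalize (r 0%nat) (r 1%nat) (r 2%nat) (r 3%nat); clear r; intros c e a v.
  split.
  - intros H; repeat (destruct H as [H | H]).
    + rewrite H; constructor.
    + destruct H as [-> ->]; constructor.
    + destruct H as (-> & x & _ & y & _ & -> & ->); constructor.
    + destruct H as (-> & x & _ & y & _ & -> & ->); constructor.
    + destruct H as (-> & x & _ & y & _ & -> & ->); constructor.
    + destruct H as (-> & x & _ & y & _ & -> & ->); constructor.
    + destruct H as (-> & x & _ & y & _ & -> & [[H ->] | [H ->]]);
        [apply j_lt_true | apply j_lt_false]; trivial.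
    + destruct H as (-> & [[H ->] | [H ->]]); [apply j_oracle_in | apply j_oracle_out]; trivial.
    + destruct H as (e1 & _ & e2 & _ & b & _ & -> & H1 & H2); apply j_comp with b; trivial.
    + destruct H as (e1 & _ & e2 & _ & u & _ & w & _ & -> & -> & H1 & H2).
      apply j_pair; trivial.
    + destruct H as (e' & _ & -> & H1 & H2); apply j_mu; trivial.
      intros u Hu; destruct (H2 u Hu) as (w & _ & K); eauto.
  - assert (B : forall k P x y v, P x y v -> binary k P (pair (num M k) 0) (pair x y) v).
    { intros k P x y w K; split; trivial; exists x; split; [apply le_pair_l |].
      exists y; split; [apply le_pair_r | auto]. }
    assert (L : forall k e1 e2, e1 < pair (num M k) (pair e1 e2) + 1 /\
                                e2 < pair (num M k) (pair e1 e2) + 1).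
    { intros k e1 e2; split.
      - exact (le_trans _ _ _ (le_pair_l e1 e2) (le_pair_r _ _)).
      - exact (le_trans _ _ _ (le_pair_r e1 e2) (le_pair_r _ _)). }
    intros H; destruct H; unfold J.
    + left; trivial.
    + right; left; auto.
    + do 2 right; left; apply B; trivial.
    + do 3 right; left; apply B; trivial.
    + do 4 right; left; apply B; trivial.
    + do 5 right; left; apply B; trivial.
    + do 6 right; left; apply B; auto.
    + do 6 right; left; apply B; auto.
    + do 7 right; left; auto.
    + do 7 right; left; auto.
    + do 8 right; left; exists e1; split; [apply L |]; exists e2; split; [apply L |].
      exists b; split; [eapply claim_le; eauto | auto].
    + do 9 right; left; exists e1; split; [apply L |]; exists e2; split; [apply L |].
      exists u; split; [eapply claim_le; eauto |].
      exists v; split; [eapply claim_le; eauto | auto].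
    + do 10 right; exists e; split; [apply le_pair_r |]; split; [trivial |].
      split; [trivial |].
      intros u Hu; destruct (H0 u Hu) as (w & Hw & K); exists w.
      split; [eapply claim_le; eauto | auto].
Qed.

Lemma D0_W_stage (A : M -> Prop) : D0 (fun r => A (r 0%nat)) ->
  D0 (fun r => W_stage A (r 0%nat) (r 1%nat) (r 2%nat)).
Proof.
  intros HA.
  pose (J := fun c e a v => justified A (claim c) e a v).
  assert (HJ : D0 (fun r => J (r 0%nat) (r 1%nat) (r 2%nat) (r 3%nat)))
    by exact (D0_justified A HA).
  apply D0_ext with (fun r => exists c, c < r 1%nat /\ exists v, v < c + 1 /\
    (forall e, e < c + 1 -> forall a, a < c + 1 -> forall v, v < c + 1 ->
      claim c e a v -> J c e a v) /\ claim c (r 0%nat) (r 2%nat) v); [| definable].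
  intros r; split.
  - intros (c & Hc & v & _ & K & Hv); exists c, v; split; [trivial | split; [| trivial]].
    intros e a w H; destruct (claim_le _ _ _ _ H) as (? & ? & ?); apply K; trivial.
  - intros (c & v & Hc & K & Hv); exists c; split; trivial.
    exists v; split; [eapply claim_le; eauto |]; split; trivial.
    intros e _ a _ w _; apply K.
Qed.

Lemma cofinite_intersections_of_BSigma3 : BSigma M 3 -> cofinite_intersections M.
Proof.
  intros B A n f HA Hf H.
  assert (DA : D0 (fun r => A (r 0%nat))) by (apply D0_set; [trivial | term]).
  pose proof (D0_W_stage A DA) as DW; pose proof (computable_definable f Hf) as Df.
  pose (F := fun x y => f x = y); change (D0 (fun r => F (r 0%nat) (r 1%nat))) in Df.
  (* The single number [s] bounds both the stage and the value [f i], which enters as [e] through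
     its graph; this keeps the matrix Delta^0_0. *)
  pose (Q := fun s x i b => b < x -> exists e, e < s + 1 /\ F i e /\ W_stage A e s x).
  assert (DQ : D0 (fun r => Q (r 0%nat) (r 1%nat) (r 2%nat) (r 3%nat)))
    by (unfold Q; definable).
  destruct (D0_forms4 _ _ DQ DQ) as (p & q & rho & Hp & _ & E).
  assert (E' : forall i b, sat (i .: b .: rho) (fAll (fEx p)) <->
    forall x, b < x -> W A (f i) x).
  { intros i b; simpl; split; intros K x.
    - intros Hx; destruct (K x) as [s Hs]; apply (E s x i b) in Hs.
      destruct (Hs Hx) as (e & _ & <- & Hw); exists s; exact Hw.
    - destruct (classic (b < x)) as [Hx | Hx].
      + destruct (K x Hx) as (s & c & v & Hc & Hw); exists (s + f i); apply E; intros _.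
        exists (f i); split; [apply le_add_r |]; split; [reflexivity |].
        exists c, v; split; [exact (lt_le_trans _ _ _ Hc (le_add_l _ _)) | exact Hw].
      + exists 0; apply E; intros Hx'; contradiction. }
  destruct (B (fAll (fEx p)) rho n) as [b Hb].
  - apply Sigma_Pi, Pi_All, Pi_Sigma, Sigma_Ex, Sigma_Pi, Pi_Delta0, Hp.
  - intros i Hi; destruct (H i Hi) as [b Hb]; exists b; apply E', Hb.
  - exists b; intros x Hx i Hi; destruct (Hb i Hi) as (c & Hc & K).
    exact (proj1 (E' i c) K x (lt_trans _ _ _ Hc Hx)).
Qed.

End Model.

Theorem theorem6 (M : structure2) (HM : RCA0star M) :
  cofinite_intersections M <-> BSigma M 3.
Proof.
  split.
  - apply BSigma3_of_cofinite_intersections, HM.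
  - apply cofinite_intersections_of_BSigma3, HM.
Qed.
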